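(* Let $a,c$ be nonzero complex numbers and let $\ell,m,n$ be nonnegative integers. Then $$ {}_4\phi_3\left[\begin{matrix}q^{-n},\,a,\,c,\,-q^{1-\ell-m-n}/(ac)\\ q^{1-\ell-n}/a,\,q^{1-m-n}/c,\,-ac\end{matrix};q,q\right] =\frac{(a,\,q^{n}a^2;q)_\ell}{(a^2,\,q^{n}a;q)_\ell}\, \frac{(-a,\,q^{m}c^2;q)_n}{(-ac,\,q^{m}c;q)_n}\sum_{i=0}^{\ell}\sum_{j=0}^{m}T_{i,j}, $$ where $$ T_{i,j}=q^{(\ell+n)i+(m+n-i)j-\binom{j}{2}}\,a^ic^{n-i}\,\frac{1-q^{2i-1}a^2}{1-q^{-1}a^2}\, \frac{(q^{-\ell},q^{-n},q^{-1}a^2;q)_i}{(q,\,q^{n}a^2,\,q^{\ell}a^2;q)_i} $$ $$ \times\frac{(q^{-m},\,q^{i-n},\,q^{1-n-i}/a^2,\,c,\,-c;q)_j}{(q,\,q^{1-n}/a,\,-q^{1-n}/a,\,q^{m}c^2,\,q^{j-1}c^2;q)_j}\, \frac{(q,\,q^{2-2n}/(a^2c^2);q^2)_{(n-i-j)/2}}{(q^{2-2n+2j}/a^2,\,q^{1+2j}c^2;q^2)_{(n-i-j)/2}}\,\chi(n-i-j). $$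
   Context: $q$ is a nonzero complex number. For complex $x$ and an integer $n\ge 0$, the $q$-shifted factorial is $(x;q)_0=1$, $(x;q)_n=\prod_{k=0}^{n-1}(1-xq^k)$, and $(x_1,\dots,x_r;q)_n=\prod_{s=1}^r (x_s;q)_n$ (likewise with base $q^2$ in place of $q$). The basic hypergeometric series is ${}_4\phi_3\left[\begin{matrix}a_0,a_1,a_2,a_3\\ b_1,b_2,b_3\end{matrix};q,z\right]=\sum_{k\ge0}\frac{(a_0,a_1,a_2,a_3;q)_k}{(q,b_1,b_2,b_3;q)_k}z^k$. Here one upper parameter is $q^{-n}$, so the series terminates and means the sum over $0\le k\le n$. Parameters are assumed to be such that no zero factor appears in a denominator of the displayed expressions. Put $\chi(k)=\{1+(-1)^k\}/2$. A term with $i+j>n$ contains the vanishing factor $(q^{-n};q)_i(q^{i-n};q)_j$ and is read as $0$; terms with $\chi(n-i-j)=0$ are also read as $0$. *)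

(* Defs.v *)
From HB Require Import structures.
From mathcomp Require Import all_boot all_order all_algebra.
Set Implicit Arguments.
Unset Strict Implicit.
Unset Printing Implicit Defensive.
Import Order.TTheory GRing.Theory Num.Theory.
Local Open Scope ring_scope.

(* (x; q)_n *)
Definition qpoch (F : fieldType) (x q : F) (n : nat) : F :=
  \prod_(k < n) (1 - x * q ^+ k).

(* (x_1, ..., x_r; q)_n *)
Definition qpochs (F : fieldType) (xs : seq F) (q : F) (n : nat) : F :=
  \prod_(x <- xs) qpoch x q n.

(* The terminating series 4phi3[q^-n, a1, a2, a3; b1, b2, b3; q, z], in which
   every term with k > n vanishes; the first upper parameter is determined
   by n and is not an argument. *)
Definition phi43 (F : fieldType) (n : nat) (a1 a2 a3 b1 b2 b3 q z : F) : F :=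
  \sum_(k < n.+1)
    qpochs [:: q ^- n; a1; a2; a3] q k / qpochs [:: q; b1; b2; b3] q k * z ^+ k.

Definition chi (F : fieldType) (k : nat) : F := (1 + (-1) ^+ k) / 2%:R.

(* T_{i,j}, set to 0 when n < i + j. For i + j <= n the natural-number
   subtraction n - i - j is exact, and the floor half (n - i - j)./2 is the
   exact half whenever the factor chi is nonzero. *)
Definition T (F : fieldType) (q a c : F) (l m n i j : nat) : F :=
  if (i + j <= n)%N then
    q ^ ((l%:Z + n%:Z) * i%:Z + (m%:Z + n%:Z - i%:Z) * j%:Z - 'C(j, 2)%:Z)
    * a ^+ i * c ^+ (n - i)
    * ((1 - q ^ (2 * i%:Z - 1) * a ^+ 2) / (1 - q^-1 * a ^+ 2))
    * (qpochs [:: q ^- l; q ^- n; q^-1 * a ^+ 2] q i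
       / qpochs [:: q; q ^+ n * a ^+ 2; q ^+ l * a ^+ 2] q i)
    * (qpochs [:: q ^- m; q ^ (i%:Z - n%:Z);
                  q ^ (1 - n%:Z - i%:Z) / a ^+ 2; c; - c] q j
       / qpochs [:: q; q ^ (1 - n%:Z) / a; - q ^ (1 - n%:Z) / a;
                    q ^+ m * c ^+ 2; q ^ (j%:Z - 1) * c ^+ 2] q j)
    * (qpochs [:: q; q ^ (2 - 2 * n%:Z) / (a ^+ 2 * c ^+ 2)]
              (q ^+ 2) (n - i - j)./2
       / qpochs [:: q ^ (2 - 2 * n%:Z + 2 * j%:Z) / a ^+ 2;
                    q ^+ (1 + 2 * j) * c ^+ 2]
                (q ^+ 2) (n - i - j)./2)
    * chi F (n - i - j)
  else 0.

(* Main.v *)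
Require Import Defs.
From HB Require Import structures.
From mathcomp Require Import all_boot all_order all_algebra.
From mathcomp Require Import complex reals.
From mathcomp Require Import ring zify.
Set Implicit Arguments.
Unset Strict Implicit.
Unset Printing Implicit Defensive.
Import Order.TTheory GRing.Theory Num.Theory.
Local Open Scope ring_scope.
Local Open Scope complex_scope.

(** Write al = a q^l and ga = c q^m. Sears' transformation turns the series into the balanced
    4phi3[q^-n, q^(n-1) a al c ga, a, -a; -ac, a al, a ga; q, q], where l enters only through
    a quotient of two q-shifted factorials. The terminating very-well-poised 6phi5 sum expands
    this quotient termwise into the corresponding quotients for l = 0 and (n - i, a q^i) in
    place of (n, a); transforming back expresses the original series through series with l = 0.
    The series is invariant under exchanging (a, l) and (c, m), so the same step removes m.
    What remains is the case l = m = 0, which is Andrews' terminating q-Watson sum; it follows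
    from a two-step recurrence in n that makes the odd cases vanish.

    The intermediate series have denominators that may vanish although those of the theorem
    do not. The identity is therefore proved for (a + t, c + t) with t outside a finite set;
    both sides are rational functions of t regular at t = 0, so it holds at t = 0 as well. *)

(** * q-shifted factorials *)

(** Negated hypotheses and equations outside [nat] abound below; they are dropped first so that
    [lia] faces only the arithmetic of indices. *)
Ltac natlia :=
  repeat match goal with
  | H : is_true (negb _) |- _ => clear H
  | H : @eq ?T _ _ |- _ => tryif unify T nat then fail else clear H
  end; lia.
Ltac nz := solve [by [] | by rewrite expf_neq0 | apply/andP; split; nz
  | by rewrite ?mulf_neq0 ?invr_neq0 ?oppr_eq0 ?expf_neq0 ?oner_eq0 //].

Lemma qpoch0 (F : fieldType) (x q : F) : qpoch x q 0 = 1.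
Proof. by rewrite /qpoch big_ord0. Qed.

Lemma qpochS (F : fieldType) (x q : F) n :
  qpoch x q n.+1 = qpoch x q n * (1 - x * q ^+ n).
Proof. by rewrite /qpoch big_ord_recr. Qed.

Lemma qpochD (F : fieldType) (x q : F) m n :
  qpoch x q (m + n) = qpoch x q m * qpoch (x * q ^+ m) q n.
Proof.
elim: n => [|n IHn]; first by rewrite addn0 qpoch0 mulr1.
by rewrite addnS !qpochS IHn exprD !mulrA.
Qed.

Lemma qpochSl (F : fieldType) (x q : F) n :
  qpoch x q n.+1 = (1 - x) * qpoch (x * q) q n.
Proof. by rewrite -add1n qpochD qpochS qpoch0 expr0 expr1 mulr1 mul1r. Qed.

Lemma qpoch_neq0P (F : fieldType) (x q : F) n :
  reflect (forall k, (k < n)%N -> x * q ^+ k != 1) (qpoch x q n != 0).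
Proof.
apply: (iffP idP) => [/prodf_neq0 h k kn|h].
  by have := h (Ordinal kn) isT; rewrite subr_eq0 eq_sym.
by apply/prodf_neq0 => k _; rewrite subr_eq0 eq_sym h.
Qed.

Lemma qpoch_neq0_le (F : fieldType) (x q : F) m n :
  (m <= n)%N -> qpoch x q n != 0 -> qpoch x q m != 0.
Proof.
move=> mn /qpoch_neq0P h; apply/qpoch_neq0P => k km; apply: h.
exact: leq_trans km mn.
Qed.

Lemma qpochs_cons (F : fieldType) (x : F) s q n :
  qpochs (x :: s) q n = qpoch x q n * qpochs s q n.
Proof. by rewrite /qpochs big_cons. Qed.

Lemma qpochs_nil (F : fieldType) (q : F) n : qpochs [::] q n = 1.
Proof. by rewrite /qpochs big_nil. Qed.

Definition qpochsE := (qpochs_cons, qpochs_nil, mulr1).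

Lemma qpoch_neq0_last (F : fieldType) (x q : F) n k :
  (k < n)%N -> qpoch x q n != 0 -> 1 - x * q ^+ k != 0.
Proof. by move=> kn /qpoch_neq0P/(_ k kn); rewrite subr_eq0 eq_sym. Qed.

Lemma qpoch_split (F : fieldType) (x q : F) j n : (j <= n)%N ->
  qpoch x q n = qpoch x q j * qpoch (x * q ^+ j) q (n - j).
Proof. by move=> jn; rewrite -qpochD subnKC. Qed.

Lemma qpoch_neq0_shift (F : fieldType) (x q : F) j n : (j <= n)%N ->
  qpoch x q n != 0 -> qpoch (x * q ^+ j) q (n - j) != 0.
Proof. by move=> jn; rewrite (qpoch_split _ _ jn) mulf_eq0 => /norP[]. Qed.

(** In the exponents, j (j + 1) = j + j^2. Reversing q-shifted factorials produces powers of q with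
    binomial exponents, which this trades for j^2. *)
Lemma expr_bin2_sqr (F : fieldType) (q : F) j :
  q ^+ 'C(j.+1, 2) * q ^+ 'C(j.+1, 2) = q ^+ j * q ^+ (j * j).
Proof.
rewrite -!exprD; congr (_ ^+ _).
by elim: j => // j IHj; rewrite binS bin1; move: IHj; natlia.
Qed.

(** * Summation formulas *)

(* All summation formulas below are WZ proofs: [P] is the partial sum found by q-Zeilberger. *)
Lemma partial_sums (F : fieldType) (f P : nat -> F) n :
  f 0%N = P 0%N ->
  (forall k, (k < n)%N -> f k.+1 = P k.+1 - P k) ->
  \sum_(k < n.+1) f k = P n.
Proof.
move=> f0; elim: n => [|n IHn] h; first by rewrite big_ord1.
rewrite big_ord_recr /= IHn ?h //; first by ring.
by move=> k kn; apply: h; apply: ltnW.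
Qed.

(* q-Pfaff-Saalschutz with the reversed parameters absorbed in [k - j]: the coefficient form of
   Heine's transformation, free of spurious denominators. *)
Lemma saalschutz_conv (F : fieldType) (q a b u : F) k :
  qpoch q q k != 0 -> qpoch (u * a * b) q k != 0 ->
  \sum_(j < k.+1) qpoch a q j * qpoch b q j * qpoch u q (k - j) * u ^+ j
     / (qpoch q q j * qpoch (u * a * b) q j * qpoch q q (k - j))
  = qpoch (u * a) q k * qpoch (u * b) q k / (qpoch q q k * qpoch (u * a * b) q k).
Proof.
elim: k => [|k IHk]; first by rewrite big_ord1 subnn !qpoch0 !expr0 !mulr1.
move=> hq hc; have hq' := qpoch_neq0_le (leqnSn k) hq.
have hc' := qpoch_neq0_le (leqnSn k) hc.
have {IHk} := IHk hq' hc'; set S := (\sum_(j < k.+1) _) => IHk.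
have nq := qpoch_neq0_last (leqnn _) hq; have nc := qpoch_neq0_last (leqnn _) hc.
set c := u * a * b in hc hc' IHk nc *.
(* The remaining length r is a separate argument, so that the summands for k and for k + 1 are both
   values of [f]. *)
pose f j r := qpoch a q j * qpoch b q j * qpoch u q r * u ^+ j
     / (qpoch q q j * qpoch c q j * qpoch q q r).
(* First-order recurrence in k. The sum stops at j = k; the right side is minus the scaled term j =
   k + 1 that the sum for k + 1 still lacks. *)
have tel : \sum_(j < k.+1) ((1 - q * q ^+ k) * (1 - c * q ^+ k) * f j (k.+1 - j)%N
  - (1 - u * a * q ^+ k) * (1 - u * b * q ^+ k) * f j (k - j)%N)
  = - (1 - a * q ^+ k) * (1 - b * q ^+ k) * u * f k 0%N.
  pose P j := - q ^+ (k - j) * (1 - a * q ^+ j) * (1 - b * q ^+ j) * u * f j (k - j)%N.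
  rewrite (partial_sums (P := P) (f := fun j =>
    (1 - q * q ^+ k) * (1 - c * q ^+ k) * f j (k.+1 - j)%N
    - (1 - u * a * q ^+ k) * (1 - u * b * q ^+ k) * f j (k - j)%N)).
  - by rewrite /P subnn expr0 mulN1r.
  - rewrite /P /f !subn0 !qpoch0 !qpochS !expr0 /c; field.
    by rewrite hq' nq.
  move=> j jk; have [r def_k] : exists r, k = (j + r).+1.
    by exists (k - j.+1)%N; natlia.
  have nj : 1 - q * q ^+ j != 0 by apply: qpoch_neq0_last hq; natlia.
  have nr : 1 - q * q ^+ r != 0 by apply: qpoch_neq0_last hq; natlia.
  have nr1 : 1 - q * q ^+ r.+1 != 0 by apply: qpoch_neq0_last hq; natlia.
  have ncj : 1 - c * q ^+ j != 0 by apply: qpoch_neq0_last hc; natlia.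
  have hqj : qpoch q q j != 0 by apply: qpoch_neq0_le hq; natlia.
  have hqr : qpoch q q r != 0 by apply: qpoch_neq0_le hq; natlia.
  have hcj : qpoch c q j != 0 by apply: qpoch_neq0_le hc; natlia.
  rewrite /P /f.
  have -> : (k.+1 - j.+1 = r.+1)%N by natlia.
  have -> : (k - j.+1 = r)%N by natlia.
  have -> : (k - j = r.+1)%N by natlia.
  have -> : q ^+ k = q ^+ j * q ^+ r * q by rewrite def_k exprS exprD; ring.
  rewrite !qpochS !exprS.
  (* [K] is the common factor of the four terms; what remains of the telescoping identity is
     polynomial. Abstracting the denominators before [field] keeps each goal small. The later
     telescoping proofs follow the same pattern. *)
  pose K := qpoch a q j * qpoch b q j * qpoch u q r * u ^+ j /
    (qpoch q q j * qpoch c q j * qpoch q q r *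
     ((1 - q * q ^+ j) * (1 - c * q ^+ j) * (1 - q * q ^+ r))).
  rewrite [X in _ * X - _](_ : _ = K * ((1 - a * q ^+ j) * (1 - b * q ^+ j)
    * (1 - u * q ^+ r) * u)); last first.
    rewrite /K; move: (1 - q * _) (1 - c * _) (1 - q * _) nj ncj nr => d1 d2 d3 *.
    by field; nz.
  rewrite [X in _ - _ * X = _](_ : _ = K * ((1 - a * q ^+ j) * (1 - b * q ^+ j)
    * (1 - q * q ^+ r) * u)); last first.
    rewrite /K; move: (1 - q * _) (1 - c * _) (1 - q * _) nj ncj nr => d1 d2 d3 *.
    by field; nz.
  rewrite [X in _ = _ * X - _](_ : _ = K * ((1 - a * q ^+ j) * (1 - b * q ^+ j)
    * (1 - q * q ^+ r) * u)); last first.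
    rewrite /K; move: (1 - q * _) (1 - c * _) (1 - q * _) nj ncj nr => d1 d2 d3 *.
    by field; nz.
  rewrite [X in _ = _ - _ * X](_ : _ = K * ((1 - q * q ^+ j) * (1 - c * q ^+ j)
    * (1 - u * q ^+ r))); last first.
    rewrite /K; move: (1 - q * _) (1 - c * _) (1 - q * _) nj ncj nr => d1 d2 d3 *.
    by field; nz.
  by rewrite /c; ring.
rewrite sumrB -!mulr_sumr -/(f _ _) in tel.
have -> : \sum_(j < k.+2) qpoch a q j * qpoch b q j * qpoch u q (k.+1 - j) * u ^+ j
     / (qpoch q q j * qpoch c q j * qpoch q q (k.+1 - j))
   = \sum_(j < k.+1) f j (k.+1 - j)%N + f k.+1 0%N.
  by rewrite big_ord_recr /= subnn.
have eS : S = \sum_(j < k.+1) f j (k - j)%N by [].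
rewrite -eS IHk in tel.
apply: (mulfI (mulf_neq0 nq nc)); rewrite mulrDr.
move/(canRL (subrK _)): tel => ->.
rewrite /f !qpochS !qpoch0 exprS; field; nz.
Qed.

Lemma qpoch_expVn (F : fieldType) (q : F) n k :
  q != 0 -> (n < k)%N -> qpoch (q ^- n) q k = 0.
Proof.
move=> q0 nk; apply/eqP; rewrite /qpoch prodf_seq_eq0; apply/hasP.
exists (Ordinal nk); first exact: mem_index_enum.
by rewrite /= mulVf ?subrr // expf_neq0.
Qed.

(** Induction on n by a first-order recurrence. Writing the lower parameters as multiples of x puts
    the balancing condition into the third upper parameter and leaves [al] and [ga] themselves on
    the right. *)
Lemma saalschutz (F : fieldType) (q x al ga : F) n :
  q != 0 -> qpoch q q n != 0 -> qpoch (x * al) q n != 0 ->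
  qpoch (x * ga) q n != 0 ->
  \sum_(s < n.+1) qpoch (q ^- n) q s * qpoch x q s
      * qpoch (q ^+ n / q * (x * al * ga)) q s
      / (qpoch q q s * qpoch (x * al) q s * qpoch (x * ga) q s) * q ^+ s
  = qpoch al q n * qpoch ga q n / (qpoch (x * al) q n * qpoch (x * ga) q n)
    * x ^+ n.
Proof.
move=> q0; set w := x * al * ga.
elim: n => [|n IHn]; first by rewrite big_ord1 !qpoch0 !expr0 !mulr1.
move=> hq ha hg.
have hq' := qpoch_neq0_le (leqnSn n) hq.
have ha' := qpoch_neq0_le (leqnSn n) ha.
have hg' := qpoch_neq0_le (leqnSn n) hg.
have {IHn} := IHn hq' ha' hg'.
have nq := qpoch_neq0_last (leqnn _) hq.
have na := qpoch_neq0_last (leqnn _) ha.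
have ng := qpoch_neq0_last (leqnn _) hg.
pose t N s := qpoch (q ^- N) q s * qpoch x q s * qpoch (q ^+ N / q * w) q s
      / (qpoch q q s * qpoch (x * al) q s * qpoch (x * ga) q s) * q ^+ s.
rewrite -[X in X = _]/(\sum_(s < n.+1) t n s)
  -[X in _ -> X = _]/(\sum_(s < n.+2) t n.+1 s).
move=> IHn.
(* Summing up to s = n + 1 makes the recurrence homogeneous: the certificate there contains
   (q^-n;q)_(n+1) = 0. *)
have tel : \sum_(s < n.+2)
  ((1 - x * al * q ^+ n) * (1 - x * ga * q ^+ n) * t n.+1 s
   - x * (1 - al * q ^+ n) * (1 - ga * q ^+ n) * t n s) = 0.
  pose P s := (1 - w * q ^+ n * q ^+ n) * (qpoch (q ^- n) q s * qpoch (w * q ^+ n) q s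
     * qpoch x q s.+1 / (qpoch q q s * qpoch (x * al) q s * qpoch (x * ga) q s)).
  rewrite (partial_sums (P := P) (f := fun s =>
   (1 - x * al * q ^+ n) * (1 - x * ga * q ^+ n) * t n.+1 s
   - x * (1 - al * q ^+ n) * (1 - ga * q ^+ n) * t n s)).
  - by rewrite /P qpoch_expVn // !(mul0r, mulr0).
  - by rewrite /P /t !qpochS !qpoch0 !expr0 /w; field; nz.
  move=> s; rewrite ltnS => sn.
  have nqs : 1 - q * q ^+ s != 0 by apply: qpoch_neq0_last hq.
  have nas : 1 - x * al * q ^+ s != 0 by apply: qpoch_neq0_last ha.
  have ngs : 1 - x * ga * q ^+ s != 0 by apply: qpoch_neq0_last hg.
  have hqs : qpoch q q s != 0 by apply: qpoch_neq0_le hq'.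
  have has : qpoch (x * al) q s != 0 by apply: qpoch_neq0_le ha'.
  have hgs : qpoch (x * ga) q s != 0 by apply: qpoch_neq0_le hg'.
  pose K := qpoch (q ^- n) q s * qpoch x q s * qpoch (w * q ^+ n) q s
    * (1 - x * q ^+ s)
    / (qpoch q q s * qpoch (x * al) q s * qpoch (x * ga) q s
     * ((1 - q * q ^+ s) * (1 - x * al * q ^+ s) * (1 - x * ga * q ^+ s))).
  have qn0 : q ^+ n != 0 by rewrite expf_neq0.
  have e1 : t n.+1 s.+1
    = K * ((1 - q ^- n / q) * (1 - w * q ^+ n * q ^+ s) * (q ^+ s * q)).
    rewrite /t /K qpochSl (_ : q ^- n.+1 * q = q ^- n); last first.
      by rewrite exprS invfM mulrAC mulVf ?mul1r.
    rewrite (_ : q ^+ n.+1 / q * w = w * q ^+ n); last first.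
      by rewrite exprS; field.
    rewrite !qpochS !exprS.
    move: (1 - q * q ^+ s) (1 - x * al * _) (1 - x * ga * _) nqs nas ngs => d1 d2 d3 *.
    by field; nz.
  have e2 : t n s.+1 = K * ((1 - q ^- n * q ^+ s) * (1 - w * q ^+ n / q) * (q ^+ s * q)).
    rewrite /t /K (qpochS (q ^- n)) (qpochSl (_ / q * w)).
    rewrite (_ : q ^+ n / q * w * q = w * q ^+ n); last by field.
    rewrite !qpochS !exprS.
    move: (1 - q * q ^+ s) (1 - x * al * _) (1 - x * ga * _) nqs nas ngs => d1 d2 d3 *.
    by field; nz.
  have e3 : P s.+1 = (1 - w * q ^+ n * q ^+ n) * K
    * ((1 - q ^- n * q ^+ s) * (1 - w * q ^+ n * q ^+ s) * (1 - x * q ^+ s * q)).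
    rewrite /P /K !qpochS !exprS.
    move: (1 - q * q ^+ s) (1 - x * al * _) (1 - x * ga * _) nqs nas ngs => d1 d2 d3 *.
    by field; nz.
  have e4 : P s = (1 - w * q ^+ n * q ^+ n) * K
    * ((1 - q * q ^+ s) * (1 - x * al * q ^+ s) * (1 - x * ga * q ^+ s)).
    rewrite /P /K !qpochS.
    move: (1 - q * q ^+ s) (1 - x * al * _) (1 - x * ga * _) nqs nas ngs => d1 d2 d3 *.
    by field; nz.
  rewrite e1 e2 e3 e4 /w.
  clear e1 e2 e3 e4; move: (K) (q ^+ n) (q ^+ s) qn0 => L X Y X0; field; nz.
rewrite sumrB -!mulr_sumr [X in _ - _ * X]big_ord_recr /= IHn in tel.
rewrite /t qpoch_expVn // !mul0r addr0 in tel.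
apply: (mulfI (mulf_neq0 na ng)).
move/(canRL (subrK _)): tel => ->.
by rewrite !qpochS exprS; field; nz.
Qed.

(** * Transformation formulas *)

(** The last j factors of (y;q)_n are read backwards, using 1 - y q^s = -y q^s (1 - q^-s / y). The
    form without division holds even if some factors vanish. *)
Lemma qpoch_rev (F : fieldType) (q y : F) n j :
  q != 0 -> y != 0 -> (j <= n)%N ->
  qpoch (q / q ^+ n / y) q j * qpoch y q (n - j) * ((- y) ^+ j * q ^+ (n * j))
  = qpoch y q n * q ^+ 'C(j.+1, 2).
Proof.
move=> q0 y0; elim: j => [|j IHj] jn.
  by rewrite subn0 qpoch0 muln0 !expr0 !mulr1 mul1r.
have [r def_n] : exists r, n = (r + j.+1)%N by exists (n - j.+1)%N; natlia.
have := IHj (ltnW jn).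
rewrite (_ : n - j = r.+1)%N; last by natlia.
rewrite (_ : n - j.+1 = r)%N; last by natlia.
have -> : q ^+ 'C(j.+2, 2) = q ^+ 'C(j.+1, 2) * (q * q ^+ j).
  by rewrite binS bin1 exprD exprS.
rewrite mulrA => /(congr1 (fun z => z * (q * q ^+ j))); rewrite -!mulrA => <-.
rewrite !qpochS mulnS exprD !exprS !mulrA.
have -> : q ^+ n = q ^+ r * (q * q ^+ j) by rewrite def_n exprD exprS.
have qr0 : q ^+ r != 0 by rewrite expf_neq0.
have qj0 : q ^+ j != 0 by rewrite expf_neq0.
move: (qpoch _ q j) (q ^+ (n * j)) ((- y) ^+ j) => P M E.
by field; nz.
Qed.

Lemma qpoch_rev_neq0 (F : fieldType) (q y : F) n j :
  q != 0 -> y != 0 -> (j <= n)%N -> qpoch y q n != 0 ->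
  qpoch (q / q ^+ n / y) q j != 0.
Proof.
move=> q0 y0 jn hy; have := qpoch_rev q0 y0 jn.
case: eqP => // -> /esym/eqP; rewrite !mul0r mulf_eq0 (negPf hy) /=.
by rewrite expf_eq0 (negPf q0) andbF.
Qed.

Lemma sum_triangle (V : nmodType) (f : nat -> nat -> V) n :
  \sum_(k < n.+1) \sum_(j < k.+1) f j (k - j)%N
  = \sum_(j < n.+1) \sum_(s < (n - j).+1) f j s.
Proof.
elim: n => [|n IHn]; first by rewrite !big_ord1.
rewrite big_ord_recr /= IHn [RHS]big_ord_recr /= [X in _ + X]big_ord_recr /=.
rewrite subnn big_ord1 addrA -big_split /=; congr (_ + _).
apply: eq_bigr => j _; rewrite (_ : n.+1 - j = (n - j).+1)%N ?big_ord_recr //.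
by have := ltn_ord j; natlia.
Qed.

(* Sears' transformation: expand two upper parameters over one lower parameter by
   [saalschutz_conv], then sum the inner series by [saalschutz]. *)
Lemma sears (F : fieldType) (q x b c al ga : F) n (u := q ^+ n / q * (x * al * ga)) :
  q != 0 -> x != 0 -> al != 0 -> ga != 0 ->
  qpoch q q n != 0 -> qpoch (u * b * c) q n != 0 ->
  qpoch al q n != 0 -> qpoch ga q n != 0 ->
  qpoch (x * al) q n != 0 -> qpoch (x * ga) q n != 0 ->
  phi43 n x (u * b) (u * c) (u * b * c) (x * al) (x * ga) q q
  = qpoch al q n * qpoch ga q n / (qpoch (x * al) q n * qpoch (x * ga) q n)
    * x ^+ n * phi43 n x b c (u * b * c) (q / q ^+ n / al) (q / q ^+ n / ga) q q.
Proof.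
move=> q0 x0 al0 ga0 hq hD hal hga ha hg.
(* [g] collects the factors in k and [h] those in j. With k = j + s, the value of u for (n, x) is
   also the one for (n - j, x q^j), so the inner sum over s is again balanced. *)
pose g k := qpoch (q ^- n) q k * qpoch x q k
  / (qpoch (x * al) q k * qpoch (x * ga) q k) * q ^+ k.
pose h j := qpoch b q j * qpoch c q j * u ^+ j / (qpoch q q j * qpoch (u * b * c) q j).
rewrite /phi43 (eq_bigr (fun k : 'I_n.+1 => \sum_(j < k.+1)
   (g (j + (k - j))%N * h j * (qpoch u q (k - j) / qpoch q q (k - j))))); last first.
  move=> k _; have kn : (k <= n)%N by rewrite -ltnS.
  have hqk := qpoch_neq0_le kn hq; have hDk := qpoch_neq0_le kn hD.
  have hak := qpoch_neq0_le kn ha; have hgk := qpoch_neq0_le kn hg.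
  transitivity (g k * (qpoch (u * b) q k * qpoch (u * c) q k
     / (qpoch q q k * qpoch (u * b * c) q k))).
    by rewrite /g !qpochsE; field; nz.
  rewrite -saalschutz_conv // mulr_sumr; apply: eq_bigr => j _.
  have jk : (j <= k)%N by rewrite -ltnS.
  have hqj := qpoch_neq0_le jk hqk; have hDj := qpoch_neq0_le jk hDk.
  have hqkj := qpoch_neq0_le (leq_subr j k) hqk.
  by rewrite subnKC // /h; field; nz.
rewrite (sum_triangle (fun j s => g (j + s)%N * h j * (qpoch u q s / qpoch q q s))).
rewrite mulr_sumr; apply: eq_bigr => j _.
have jn : (j <= n)%N by rewrite -ltnS.
have hqj := qpoch_neq0_le jn hq; have hDj := qpoch_neq0_le jn hD.
have haj := qpoch_neq0_le jn ha; have hgj := qpoch_neq0_le jn hg.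
have hqN := qpoch_neq0_le (leq_subr j n) hq.
set N := (n - j)%N.
have eN : n = (j + N)%N by rewrite /N subnKC.
have eqn : q ^+ n = q ^+ j * q ^+ N by rewrite -exprD -eN.
have haN : qpoch (x * q ^+ j * al) q N != 0.
  by rewrite mulrAC; apply: qpoch_neq0_shift.
have hgN : qpoch (x * q ^+ j * ga) q N != 0.
  by rewrite mulrAC; apply: qpoch_neq0_shift.
have qj0 : q ^+ j != 0 by rewrite expf_neq0.
have qN0 : q ^+ N != 0 by rewrite expf_neq0.
transitivity (g j * h j * (qpoch al q N * qpoch ga q N /
   (qpoch (x * q ^+ j * al) q N * qpoch (x * q ^+ j * ga) q N) * (x * q ^+ j) ^+ N)).
  rewrite -saalschutz // mulr_sumr; apply: eq_bigr => s _.
  have sN : (s <= N)%N by rewrite -ltnS.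
  have hqs := qpoch_neq0_le sN hqN.
  have has := qpoch_neq0_le sN haN; have hgs := qpoch_neq0_le sN hgN.
  have -> : q ^+ N / q * (x * q ^+ j * al * ga) = u.
    by rewrite /u eqn; ring.
  rewrite /g !qpochD exprD.
  have -> : q ^- n * q ^+ j = q ^- N by rewrite eqn; field; nz.
  rewrite (mulrAC x al) (mulrAC x ga).
  by field; nz.
rewrite /g /h !qpochsE.
have ra := qpoch_rev q0 al0 jn; have rg := qpoch_rev q0 ga0 jn.
have E0 : q ^+ 'C(j.+1, 2) != 0 by rewrite expf_neq0.
have R0 := qpoch_rev_neq0 q0 al0 jn hal; have R0' := qpoch_rev_neq0 q0 ga0 jn hga.
have halN := qpoch_neq0_le (leq_subr j n) hal.
have hgaN := qpoch_neq0_le (leq_subr j n) hga.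
have xqN0 : (x * q ^+ j) ^+ N != 0 by rewrite expf_neq0 // mulf_neq0.
(* This writes u^j through the powers left behind when (al;q)_n and (ga;q)_n are reversed. *)
have Hu : u ^+ j = x ^+ n * (((- al) ^+ j * q ^+ (n * j)) * ((- ga) ^+ j * q ^+ (n * j)))
    / (q ^+ 'C(j.+1, 2) * q ^+ 'C(j.+1, 2)) / (x * q ^+ j) ^+ N.
  have jj0 : q ^+ (j * j) != 0 by rewrite expf_neq0.
  have jN0 : q ^+ (j * N) != 0 by rewrite expf_neq0.
  have xN0 : x ^+ N != 0 by rewrite expf_neq0.
  rewrite expr_bin2_sqr /u !exprMn exprVn -!exprM (exprNn al) (exprNn ga).
  have -> : q ^+ (n * j) = q ^+ (j * j) * q ^+ (j * N).
    by rewrite -exprD -mulnDr -eN mulnC.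
  have -> : x ^+ n = x ^+ j * x ^+ N by rewrite -exprD -eN.
  rewrite -[(-1) ^+ j]signr_odd; case: (odd j); rewrite /= ?expr0 ?expr1; field; nz.
rewrite Hu (canRL (mulfK E0) (esym ra)) (canRL (mulfK E0) (esym rg)) -/N.
rewrite (qpoch_split (x * al) _ jn) (qpoch_split (x * ga) _ jn) -/N
  (mulrAC x al) (mulrAC x ga).
have nj0 : q ^+ (n * j) != 0 by rewrite expf_neq0.
move: (q ^+ 'C(j.+1, 2)) E0 ((- al) ^+ j) ((- ga) ^+ j) => E E0 ea eg.
move: ((x * q ^+ j) ^+ N) xqN0 => X X0.
move: (qpoch (x * q ^+ j * al) q N) haN (qpoch (x * q ^+ j * ga) q N) hgN => ? ? ? ?.
by field; nz.
Qed.

(** The terminating 6phi5 sum divided by (q;q)_k (xq;q)_k, as in Bailey's lemma: k enters the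
    summand only through 1/((q;q)_(k-i) (xq;q)_(k+i)). This makes the sum easy to insert into a
    series over k and to exchange with it. *)
Lemma very_well_poised_sum (F : fieldType) (q x b c : F) k :
  q != 0 -> b != 0 -> c != 0 -> x != 1 ->
  qpoch q q k != 0 -> qpoch (x * q) q (k + k) != 0 ->
  qpoch (x * q / b) q k != 0 -> qpoch (x * q / c) q k != 0 ->
  \sum_(i < k.+1) (1 - x * q ^+ (i + i)) / (1 - x)
      * (qpoch x q i * qpoch b q i * qpoch c q i)
      / (qpoch q q i * qpoch (x * q / b) q i * qpoch (x * q / c) q i)
      * ((-1) ^+ i * q ^+ 'C(i, 2) * (x * q / (b * c)) ^+ i)
      / (qpoch q q (k - i) * qpoch (x * q) q (k + i))
  = qpoch (x * q / (b * c)) q k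
    / (qpoch q q k * qpoch (x * q / b) q k * qpoch (x * q / c) q k).
Proof.
move=> q0 b0 c0 x1; have {}x1 : 1 - x != 0 by rewrite subr_eq0 eq_sym.
pose B := x * q / b; pose C := x * q / c; pose w := x * q / (b * c).
rewrite -/B -/C -/w.
pose f k i := (1 - x * q ^+ (i + i)) / (1 - x)
      * (qpoch x q i * qpoch b q i * qpoch c q i)
      / (qpoch q q i * qpoch B q i * qpoch C q i)
      * ((-1) ^+ i * q ^+ 'C(i, 2) * w ^+ i)
      / (qpoch q q (k - i) * qpoch (x * q) q (k + i)).
elim: k => [|k IHk] hq hx hB hC.
  rewrite big_ord1 /f subnn !qpoch0 !expr0 ; field; nz.
have hq' := qpoch_neq0_le (leqnSn k) hq.
have hx' : qpoch (x * q) q (k + k) != 0 by apply: qpoch_neq0_le hx; natlia.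
have hx'' : qpoch (x * q) q (k + k).+1 != 0 by apply: qpoch_neq0_le hx; natlia.
have hB' := qpoch_neq0_le (leqnSn k) hB.
have hC' := qpoch_neq0_le (leqnSn k) hC.
have {IHk} := IHk hq' hx' hB' hC'.
rewrite -[X in X = _]/(\sum_(i < k.+1) f k i)
  -[X in _ -> X = _]/(\sum_(i < k.+2) f k.+1 i).
move=> IHk.
have nq := qpoch_neq0_last (leqnn _) hq.
have nB := qpoch_neq0_last (leqnn _) hB.
have nC := qpoch_neq0_last (leqnn _) hC.
pose P i := w * q ^+ k * (qpoch (x * q) q i * qpoch b q i.+1 * qpoch c q i.+1
      / (qpoch q q i * qpoch B q i * qpoch C q i)
      * ((-1) ^+ i * q ^+ 'C(i, 2) * w ^+ i)
      / (qpoch q q (k - i) * qpoch (x * q) q (k.+1 + i))).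
(* The boundary value [P k] cancels the scaled term i = k + 1 of the sum for k + 1, which is left
   out here. *)
have tel : \sum_(i < k.+1)
  ((1 - q * q ^+ k) * (1 - B * q ^+ k) * (1 - C * q ^+ k) * f k.+1 i
   - (1 - w * q ^+ k) * f k i) = P k.
  apply: (partial_sums (P := P) (f := fun i =>
    (1 - q * q ^+ k) * (1 - B * q ^+ k) * (1 - C * q ^+ k) * f k.+1 i
    - (1 - w * q ^+ k) * f k i)) => [|i ik].
    rewrite /P /f !subn0 !addn0 !qpochS !qpoch0 !expr0.
    have nxk : 1 - x * q * q ^+ k != 0 by apply: qpoch_neq0_last hx; natlia.
    have hxk : qpoch (x * q) q k != 0 by apply: qpoch_neq0_le hx; natlia.
    by rewrite /B /C /w; field; nz.
  have [r def_k] : exists r, k = (i + r).+1 by exists (k - i.+1)%N; natlia.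
  have d1 : 1 - q * q ^+ i != 0 by apply: qpoch_neq0_last hq; natlia.
  have d2 : 1 - B * q ^+ i != 0 by apply: qpoch_neq0_last hB; natlia.
  have d3 : 1 - C * q ^+ i != 0 by apply: qpoch_neq0_last hC; natlia.
  have d4 : 1 - q * q ^+ r != 0 by apply: qpoch_neq0_last hq; natlia.
  have d5 : 1 - x * q * q ^+ (k + i).+1 != 0 by apply: qpoch_neq0_last hx; natlia.
  have hqi : qpoch q q i != 0 by apply: qpoch_neq0_le hq; natlia.
  have hqr : qpoch q q r != 0 by apply: qpoch_neq0_le hq; natlia.
  have hBi : qpoch B q i != 0 by apply: qpoch_neq0_le hB; natlia.
  have hCi : qpoch C q i != 0 by apply: qpoch_neq0_le hC; natlia.
  have hxi : qpoch (x * q) q (k + i).+1 != 0 by apply: qpoch_neq0_le hx; natlia.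
  have k1i : (k.+1 - i.+1 = r.+1)%N by natlia.
  have k0i : (k - i.+1 = r)%N by natlia.
  have ki : (k - i = r.+1)%N by natlia.
  have k2 : (k.+1 + i.+1 = (k + i).+2)%N by natlia.
  have k1 : (k + i.+1 = (k + i).+1)%N by natlia.
  pose K := qpoch (x * q) q i * qpoch b q i.+1 * qpoch c q i.+1
    * ((-1) ^+ i * q ^+ 'C(i, 2) * w ^+ i)
    / (qpoch q q i * qpoch B q i * qpoch C q i * qpoch q q r * qpoch (x * q) q (k + i).+1
       * ((1 - q * q ^+ i) * (1 - B * q ^+ i) * (1 - C * q ^+ i) * (1 - q * q ^+ r)
          * (1 - x * q * q ^+ (k + i).+1))).
  have bi : q ^+ 'C(i.+1, 2) = q ^+ 'C(i, 2) * q ^+ i by rewrite binS bin1 exprD.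
  have e1 : f k.+1 i.+1 = K * ((1 - x * q ^+ (i.+1 + i.+1)) * (- q ^+ i * w)).
    rewrite /f /K k1i k2 (qpochSl x) bi !(qpochS _ _ i) (qpochS q q r)
      (qpochS _ _ (k + i).+1) (exprS w) (exprS (-1)).
    move: (1 - q * q ^+ i) (1 - B * _) (1 - C * _) (1 - q * q ^+ r)
      (1 - x * q * q ^+ (k + i).+1) d1 d2 d3 d4 d5 => ? ? ? ? ? *.
    by field; nz.
  have e2 : f k i.+1 = K * ((1 - x * q ^+ (i.+1 + i.+1)) * (- q ^+ i * w)
      * (1 - q * q ^+ r) * (1 - x * q * q ^+ (k + i).+1)).
    rewrite /f /K k0i k1 (qpochSl x) bi !(qpochS _ _ i) (exprS w) (exprS (-1)).
    move: (1 - q * q ^+ i) (1 - B * _) (1 - C * _) (1 - q * q ^+ r)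
      (1 - x * q * q ^+ (k + i).+1) d1 d2 d3 d4 d5 => ? ? ? ? ? *.
    by field; nz.
  have e3 : P i.+1 = w * q ^+ k * K * ((1 - x * q * q ^+ i) * (1 - b * q ^+ i.+1)
     * (1 - c * q ^+ i.+1) * (- q ^+ i * w) * (1 - q * q ^+ r)).
    rewrite /P /K k0i k2 bi (qpochS b _ i.+1) (qpochS c _ i.+1) !(qpochS _ _ i)
       (qpochS _ _ (k + i).+1) (exprS w) (exprS (-1)).
    move: (1 - q * q ^+ i) (1 - B * _) (1 - C * _) (1 - q * q ^+ r)
      (1 - x * q * q ^+ (k + i).+1) d1 d2 d3 d4 d5 => ? ? ? ? ? *.
    by field; nz.
  have e4 : P i = w * q ^+ k * K * ((1 - q * q ^+ i) * (1 - B * q ^+ i)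
     * (1 - C * q ^+ i) * (1 - x * q * q ^+ (k + i).+1)).
    rewrite /P /K ki addSn (qpochS q q r).
    move: (1 - q * q ^+ i) (1 - B * _) (1 - C * _) (1 - q * q ^+ r)
      (1 - x * q * q ^+ (k + i).+1) d1 d2 d3 d4 d5 => ? ? ? ? ? *.
    by field; nz.
  rewrite e1 e2 e3 e4.
  have -> : q ^+ (k + i).+1 = q ^+ k * q ^+ i * q by rewrite exprS exprD; ring.
  have -> : q ^+ k = q ^+ i * q ^+ r * q by rewrite def_k exprS exprD; ring.
  rewrite exprD !exprS /B /C /w.
  clear e1 e2 e3 e4.
  move: (K) (q ^+ i) (q ^+ r) => L X Y; field; nz.
rewrite sumrB -!mulr_sumr IHk in tel.
rewrite big_ord_recr /=.
apply: (mulfI (mulf_neq0 (mulf_neq0 nq nB) nC)); rewrite mulrDr.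
move/(canRL (subrK _)): tel => ->.
have dx : 1 - x * q * q ^+ (k + k).+1 != 0 by apply: qpoch_neq0_last hx; natlia.
rewrite /P /f subnn addSn addnS (_ : k.+1 - k.+1 = 0)%N ?subnn // (qpochSl x)
  (qpochS _ _ (k + k).+1).
rewrite (_ : 1 - x * q ^+ (k + k).+2 = 1 - x * q * q ^+ (k + k).+1);
  last by rewrite exprS; ring.
rewrite binS bin1 (exprD _ _ k) !(exprS _ k) !qpoch0 !(qpochS _ _ k).
move: (1 - q * q ^+ k) (1 - B * _) (1 - C * _) (1 - x * q * q ^+ (k + k).+1)
  nq nB nC dx => ? ? ? ? *.
by field; nz.
Qed.

(** * Reduction to l = m = 0 *)

(* For x = a^2, c^2, a^2 c^2 and M large enough this excludes every zero denominator below;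
   the range starts at x/q because of the factors (a^2/q;q)_i. *)
Definition nonres (F : fieldType) (q : F) M (x : F) :=
  forall z, (z < M)%N -> x * q ^+ z != q.

Lemma nonres_shift (F : fieldType) (q x : F) M j :
  nonres q M x -> nonres q (M - j) (x * q ^+ j).
Proof. by move=> h z zM; rewrite -mulrA -exprD h //; natlia. Qed.

Lemma nonres_le (F : fieldType) (q x : F) M N : (N <= M)%N ->
  nonres q M x -> nonres q N x.
Proof. by move=> NM h z zN; apply: h; apply: leq_trans NM. Qed.

Lemma nonres_qpoch (F : fieldType) (q x : F) M z k :
  nonres q M x -> (z + k < M)%N -> qpoch (x * q ^+ z) q k != 0.
Proof.
(* The index grows by one because [nonres] compares with q whereas a zero factor means equality with
   1. *)
move=> h zk; apply/qpoch_neq0P => t tk; apply: contra_neq (h (z + t).+1 _); last by natlia.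
by rewrite exprS exprD mulrCA !mulrA => e; rewrite -!mulrA (mulrA x) e mulr1.
Qed.

Lemma nonres_qpoch0 (F : fieldType) (q x : F) M k :
  nonres q M x -> (k < M)%N -> qpoch x q k != 0.
Proof. by move=> h kM; rewrite -[x]mulr1 -(expr0 q) (nonres_qpoch h). Qed.

(** If x q^s = 1, then x^2 q^(2s) = 1, whence the doubled bound. Since only x^2 is constrained, the
    lemma also serves -x. *)
Lemma nonres_qpoch_sqrt (F : fieldType) (q x : F) M z k :
  nonres q M (x ^+ 2) -> ((z + k).*2 <= M)%N -> qpoch (x * q ^+ z) q k != 0.
Proof.
move=> h zk; apply/qpoch_neq0P => t tk.
apply: contra_neq (h ((z + t) + (z + t)).+1 _); last by natlia.
move=> e; rewrite (exprS q) !exprD.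
by transitivity (q * (x * q ^+ z * q ^+ t) ^+ 2); [ring | rewrite e expr1n mulr1].
Qed.

Lemma nonres_qpoch_sqrt0 (F : fieldType) (q x : F) M k :
  nonres q M (x ^+ 2) -> (k.*2 <= M)%N -> qpoch x q k != 0.
Proof. by move=> h kM; rewrite -[x]mulr1 -(expr0 q) (nonres_qpoch_sqrt h). Qed.

(* The series of the theorem is the case al = a q^l, ga = c q^m. *)
Definition phi_dixon (F : fieldType) (q : F) n a c al ga :=
  phi43 n a c (- (q / q ^+ n / (al * ga))) (q / q ^+ n / al) (q / q ^+ n / ga)
    (- (a * c)) q q.

Lemma phi_dixonC (F : fieldType) (q : F) n a c al ga :
  phi_dixon q n a c al ga = phi_dixon q n c a ga al.
Proof.
rewrite /phi_dixon /phi43 (mulrC al) (mulrC a); apply: eq_bigr => k _.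
by rewrite !qpochsE; congr (_ * _ / (_ * _) * _); ring.
Qed.

(** This is [sears] solved for its right-hand series, with last two upper parameters c and d chosen
    so that u d = -a. Afterwards the dependence on [al] inside the series is confined to one upper
    and one lower parameter, the quotient that the next expansion acts on. *)
Lemma phi_dixon_sears (F : fieldType) (q a c al ga : F) n :
  q != 0 -> a != 0 -> al != 0 -> ga != 0 ->
  qpoch q q n != 0 -> qpoch (- (a * c)) q n != 0 ->
  qpoch al q n != 0 -> qpoch ga q n != 0 ->
  qpoch (a * al) q n != 0 -> qpoch (a * ga) q n != 0 ->
  phi_dixon q n a c al ga
  = qpoch (a * al) q n * qpoch (a * ga) q n / (qpoch al q n * qpoch ga q n * a ^+ n)
    * phi43 n a (q ^+ n / q * (a * al * ga) * c) (- a) (- (a * c)) (a * al) (a * ga) q q.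
Proof.
move=> q0 a0 al0 ga0 hq hac hal hga haal haga.
have qn0 : q ^+ n != 0 by rewrite expf_neq0.
have an0 : a ^+ n != 0 by rewrite expf_neq0.
pose u := q ^+ n / q * (a * al * ga); pose d := - (q / q ^+ n / (al * ga)).
have e1 : u * d = - a by rewrite /u /d; field; nz.
have e2 : u * c * d = - (a * c) by rewrite mulrAC e1; ring.
have := @sears F q a c d al ga n q0 a0 al0 ga0 hq.
rewrite -/u e2 e1 => -> //; rewrite /phi_dixon -/d.
have -> : phi43 n a c d (q / q ^+ n / al) (q / q ^+ n / ga) (- (a * c)) q q
   = phi43 n a c d (- (a * c)) (q / q ^+ n / al) (q / q ^+ n / ga) q q.
  apply: eq_bigr => k _; rewrite !qpochsE; congr (_ / (_ * _) * _); ring.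
by field; nz.
Qed.

(* The coefficient of the series with (n, a, l) replaced by (n - i, a q^i, 0). *)
Definition dixon_coef (F : fieldType) (q : F) l n (a c ga : F) i :=
  a ^+ i * q ^+ ((l + n) * i) * (1 - a ^+ 2 / q * q ^+ (i + i)) / (1 - a ^+ 2 / q)
  * (qpoch (a ^+ 2 / q) q i * qpoch (q ^- l) q i * qpoch (q ^- n) q i)
  / (qpoch q q i * qpoch (a ^+ 2 * q ^+ l) q i)
  * (qpoch (a ^+ 2 * q ^+ l) q n * qpoch a q n * qpoch (- a) q i
      * qpoch (c * ga) q n * qpoch ga q (n - i))
  / (qpoch (a * q ^+ l) q n * qpoch ga q n * qpoch (c * ga) q (n - i)
      * qpoch (- (a * c)) q i * qpoch (a ^+ 2) q (n + i)).

(* The very-well-poised sum expands ((y q^l)_k / (a^2 q^l)_k) termwise; each piece is again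
   a balanced series of the same shape. *)
Lemma balanced_expand (F : fieldType) (q a c ga : F) l n
    (y := q ^+ n / q * (a ^+ 2 * ga) * c) :
  q != 0 -> a != 0 -> c != 0 -> ga != 0 -> a ^+ 2 != q ->
  qpoch q q n != 0 -> qpoch (a ^+ 2) q (n + n) != 0 ->
  qpoch (a ^+ 2 * q ^+ l) q n != 0 -> qpoch y q n != 0 ->
  qpoch (- (a * c)) q n != 0 -> qpoch (a * ga) q n != 0 ->
  phi43 n a (y * q ^+ l) (- a) (- (a * c)) (a ^+ 2 * q ^+ l) (a * ga) q q
  = \sum_(i < n.+1)
      (1 - a ^+ 2 / q * q ^+ (i + i)) / (1 - a ^+ 2 / q)
      * (qpoch (a ^+ 2 / q) q i * qpoch (q ^- l) q i * qpoch (q / q ^+ n / (c * ga)) q i)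
      / (qpoch q q i * qpoch (a ^+ 2 * q ^+ l) q i)
      * ((-1) ^+ i * q ^+ 'C(i, 2) * (y * q ^+ l) ^+ i)
      * (qpoch (q ^- n) q i * qpoch a q i * qpoch (- a) q i * q ^+ i)
      / (qpoch (- (a * c)) q i * qpoch (a * ga) q i * qpoch (a ^+ 2) q (i + i))
      * phi43 (n - i) (a * q ^+ i) (y * q ^+ i) (- (a * q ^+ i)) (- (a * q ^+ i * c))
         (a ^+ 2 * q ^+ (i + i)) (a * q ^+ i * ga) q q.
Proof.
move=> q0 a0 c0 ga0 a2q hq ha2 hal hy hac hag.
have ql0 : q ^+ l != 0 by rewrite expf_neq0.
have qn0 : q ^+ n != 0 by rewrite expf_neq0.
have y0 : y != 0 by rewrite /y !mulf_neq0 ?invr_neq0 ?expf_neq0.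
(* With these values xq/b, xq/d and xq/(bd) become a^2 q^l, y and y q^l, so the right side of the
   very-well-poised sum contains the quotient to be expanded. *)
pose x := a ^+ 2 / q; pose b := q ^- l; pose d := q / q ^+ n / (c * ga).
have xq : x * q = a ^+ 2 by rewrite /x mulfVK.
have xqb : x * q / b = a ^+ 2 * q ^+ l by rewrite xq /b invrK.
have xqd : x * q / d = y by rewrite xq /d /y; field; nz.
have xqbd : x * q / (b * d) = y * q ^+ l by rewrite xq /b /d /y; field; nz.
have b0 : b != 0 by rewrite invr_neq0.
have d0 : d != 0 by rewrite /d !mulf_neq0 ?invr_neq0 ?mulf_neq0.
have x1 : x != 1 by rewrite /x; apply: contra_neq a2q => /(canRL (mulfVK q0)); rewrite mul1r.
(* The extra factor (y;q)_k compensates for the denominator (xq/d;q)_k of the inserted sum. *)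
pose g k := qpoch (q ^- n) q k * qpoch a q k * qpoch (- a) q k * qpoch y q k
   / (qpoch (- (a * c)) q k * qpoch (a * ga) q k) * q ^+ k.
pose h i := (1 - x * q ^+ (i + i)) / (1 - x)
      * (qpoch x q i * qpoch b q i * qpoch d q i)
      / (qpoch q q i * qpoch (a ^+ 2 * q ^+ l) q i * qpoch y q i)
      * ((-1) ^+ i * q ^+ 'C(i, 2) * (y * q ^+ l) ^+ i).
rewrite {1}/phi43 (eq_bigr (fun k : 'I_n.+1 => \sum_(i < k.+1)
   (g (i + (k - i))%N * h i
    / (qpoch q q (k - i) * qpoch (a ^+ 2) q (i + i + (k - i)))))); last first.
  move=> k _; have kn : (k <= n)%N by rewrite -ltnS.
  have hqk := qpoch_neq0_le kn hq; have halk := qpoch_neq0_le kn hal.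
  have hyk := qpoch_neq0_le kn hy; have hack := qpoch_neq0_le kn hac.
  have hagk := qpoch_neq0_le kn hag.
  have ha2k := qpoch_neq0_le (leq_add kn kn) ha2.
  transitivity (g k * (qpoch (x * q / (b * d)) q k
    / (qpoch q q k * qpoch (x * q / b) q k * qpoch (x * q / d) q k))).
    rewrite xqbd xqb xqd /g !qpochsE; field; nz.
  rewrite -very_well_poised_sum // ?xqbd ?xqb ?xqd ?xq //.
  rewrite mulr_sumr; apply: eq_bigr => i _.
  have ik : (i <= k)%N by rewrite -ltnS.
  by rewrite -addnA subnKC // (addnC i k) /h !mulrA.
rewrite (sum_triangle (fun i s => g (i + s)%N * h i
  / (qpoch q q s * qpoch (a ^+ 2) q (i + i + s)))).
apply: eq_bigr => i _; have iN : (i <= n)%N by rewrite -ltnS.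
rewrite mulr_sumr; apply: eq_bigr => s _.
have sN : (s <= n - i)%N by rewrite -ltnS.
have eN : n = (i + (n - i))%N by rewrite subnKC.
have nx : 1 - a ^+ 2 / q != 0 by rewrite subr_eq0 eq_sym.
have hqi := qpoch_neq0_le iN hq; have hali := qpoch_neq0_le iN hal.
have hyi := qpoch_neq0_le iN hy; have haci := qpoch_neq0_le iN hac.
have hagi := qpoch_neq0_le iN hag.
have ha2i := qpoch_neq0_le (leq_add iN iN) ha2.
have hqs : qpoch q q s != 0 by apply: qpoch_neq0_le hq; natlia.
have hys := qpoch_neq0_le sN (qpoch_neq0_shift iN hy).
have hacs := qpoch_neq0_le sN (qpoch_neq0_shift iN hac).
have hags := qpoch_neq0_le sN (qpoch_neq0_shift iN hag).
have ha2s : qpoch (a ^+ 2 * q ^+ (i + i)) q s != 0.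
  by apply: qpoch_neq0_le (qpoch_neq0_shift (leq_add iN iN) ha2); natlia.
rewrite /g /h !qpochsE !qpochD exprD.
have qi0 : q ^+ i != 0 by rewrite expf_neq0.
have -> : q ^- n * q ^+ i = q ^- (n - i).
  rewrite [X in X^-1 * _](_ : _ = q ^+ i * q ^+ (n - i)); last by rewrite -exprD -eN.
  by field; rewrite qi0 expf_neq0.
have qN0 : q ^+ (n - i) != 0 by rewrite expf_neq0.
rewrite !mulNr (mulrAC a c) (mulrAC a ga) -/x -/b -/d.
rewrite !mulNr (mulrAC a c) (mulrAC a ga) in hacs hags.
rewrite -/x in nx.
have [ha2i1 ha2i2] : qpoch (a ^+ 2) q i != 0 /\ qpoch (a ^+ 2 * q ^+ i) q i != 0.
  by move: ha2i; rewrite qpochD mulf_eq0 => /norP[].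
by field; nz.
Qed.

Lemma dixon_expand (F : fieldType) (q a c : F) l m n :
  q != 0 -> a != 0 -> c != 0 -> qpoch q q n != 0 ->
  nonres q (l + m + n).+1.*2 (a ^+ 2) -> nonres q (l + m + n).+1.*2 (c ^+ 2) ->
  nonres q (l + m + n).+1.*2 ((a * c) ^+ 2) ->
  phi_dixon q n a c (a * q ^+ l) (c * q ^+ m)
  = \sum_(i < n.+1) dixon_coef q l n a c (c * q ^+ m) i
      * phi_dixon q (n - i) (a * q ^+ i) c (a * q ^+ i) (c * q ^+ m).
Proof.
move=> q0 a0 c0 hq na nc nac; set ga := c * q ^+ m.
have ql0 : q ^+ l != 0 by rewrite expf_neq0.
have qm0 : q ^+ m != 0 by rewrite expf_neq0.
have qn0 : q ^+ n != 0 by rewrite expf_neq0.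
have ga0 : ga != 0 by rewrite mulf_neq0.
have al0 : a * q ^+ l != 0 by rewrite mulf_neq0.
have ha2 : qpoch (a ^+ 2) q (n + n) != 0 by apply: nonres_qpoch0 na _; natlia.
have hal : qpoch (a * q ^+ l) q n != 0 by apply: nonres_qpoch_sqrt na _; natlia.
have hga : qpoch ga q n != 0 by apply: nonres_qpoch_sqrt nc _; natlia.
have haga : qpoch (a * ga) q n != 0.
  by rewrite /ga mulrA; apply: nonres_qpoch_sqrt nac _; natlia.
have haal : qpoch (a ^+ 2 * q ^+ l) q n != 0 by apply: nonres_qpoch na _; natlia.
have hac : qpoch (- (a * c)) q n != 0.
  by apply: (@nonres_qpoch_sqrt0 _ _ _ (l + m + n).+1.*2); rewrite ?sqrrN //; natlia.
have hcga : qpoch (c * ga) q n != 0.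
  by rewrite /ga mulrA -expr2; apply: nonres_qpoch nc _; natlia.
have a2q : a ^+ 2 != q by have := na 0%N isT; rewrite mulr1.
pose y := q ^+ n / q * (a ^+ 2 * ga) * c.
have hy : qpoch y q n != 0.
  (* As y = q^(n+m-1) (ac)^2, the equation y q^t = 1 would give (ac)^2 q^(n+m+t) = q. *)
  apply/qpoch_neq0P => t tn; apply: contra_neq (nac (n + m + t)%N _); last by natlia.
  move=> e; rewrite -[RHS]mulr1 -e /y /ga !exprD; field; nz.
rewrite phi_dixon_sears // ?(mulrA a a) -?expr2 //.
have -> : q ^+ n / q * (a ^+ 2 * q ^+ l * ga) * c = y * q ^+ l by rewrite /y; ring.
rewrite balanced_expand // mulr_sumr; apply: eq_bigr => i _.
have iN : (i <= n)%N by rewrite -ltnS.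
set N := (n - i)%N; have eN : n = (i + N)%N by rewrite subnKC.
have eqn : q ^+ n = q ^+ i * q ^+ N by rewrite -exprD -eN.
have qi0 : q ^+ i != 0 by rewrite expf_neq0.
have qN0 : q ^+ N != 0 by rewrite expf_neq0.
have ai0 : a * q ^+ i != 0 by rewrite mulf_neq0.
have hqN : qpoch q q N != 0 by apply: qpoch_neq0_le hq; rewrite leq_subr.
have hacN : qpoch (- (a * q ^+ i * c)) q N != 0.
  by rewrite mulrAC -mulNr; apply: qpoch_neq0_shift.
have haiN : qpoch (a * q ^+ i) q N != 0 by apply: nonres_qpoch_sqrt na _; natlia.
have hgaN : qpoch ga q N != 0 by apply: qpoch_neq0_le hga; rewrite leq_subr.
have ha2N : qpoch (a ^+ 2 * q ^+ (i + i)) q N != 0 by apply: nonres_qpoch na _; natlia.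
have hagN : qpoch (a * q ^+ i * ga) q N != 0.
  by rewrite mulrAC; apply: qpoch_neq0_shift.
have a2i : a * q ^+ i * (a * q ^+ i) = a ^+ 2 * q ^+ (i + i) by rewrite exprD; ring.
(* Sears' transformation of the target series for (N, a q^i) yields the balanced series already
   present on the left, so only coefficients remain to be compared. *)
rewrite [phi_dixon _ N _ _ _ _]phi_dixon_sears // ?a2i //.
have -> : q ^+ N / q * (a ^+ 2 * q ^+ (i + i) * ga) * c = y * q ^+ i.
  by rewrite /y eqn exprD; ring.
have haNi : (a * q ^+ i) ^+ N != 0 by rewrite expf_neq0.
move: (phi43 N _ _ _ _ _ _ _ _) => PHI; rewrite !(mulrA _ _ PHI); congr (_ * PHI) => {PHI}.
rewrite /dixon_coef -/N.
have nx : 1 - a ^+ 2 / q != 0.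
  by rewrite subr_eq0 eq_sym; apply: contra_neq a2q => /(canRL (mulfVK q0)); rewrite mul1r.
have hqi := qpoch_neq0_le iN hq; have haali := qpoch_neq0_le iN haal.
have haci := qpoch_neq0_le iN hac; have hagi := qpoch_neq0_le iN haga.
have ha2i : qpoch (a ^+ 2) q (i + i) != 0 by apply: qpoch_neq0_le ha2; natlia.
have hcgN : qpoch (c * ga) q N != 0 by apply: qpoch_neq0_le hcga; rewrite leq_subr.
have an0 : a ^+ n != 0 by rewrite expf_neq0.
have aN0 : a ^+ N != 0 by rewrite expf_neq0.
have ain0 : a ^+ i != 0 by rewrite expf_neq0.
have cgi0 : (- (c * ga)) ^+ i != 0 by rewrite expf_neq0 // oppr_eq0 mulf_neq0.
have E0 : q ^+ 'C(i.+1, 2) != 0 by rewrite expf_neq0.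
have qni0 : q ^+ (n * i) != 0 by rewrite expf_neq0.
have cg0 : c * ga != 0 by rewrite mulf_neq0.
have rev := qpoch_rev q0 cg0 iN; rewrite -/N in rev.
have -> : qpoch (q / q ^+ n / (c * ga)) q i
  = qpoch (c * ga) q n * q ^+ 'C(i.+1, 2)
    / (qpoch (c * ga) q N * ((- (c * ga)) ^+ i * q ^+ (n * i))).
  by rewrite -rev; field; nz.
have -> : (n + i = i + i + N)%N by natlia.
rewrite (qpochD (a ^+ 2) q (i + i) N) (qpoch_split a _ iN) (qpoch_split (a * ga) _ iN) -/N.
rewrite (mulrAC a ga).
have bi : q ^+ 'C(i.+1, 2) = q ^+ 'C(i, 2) * q ^+ i by rewrite binS bin1 exprD.
have qii : q ^+ (i * i) = q ^+ 'C(i, 2) * q ^+ 'C(i, 2) * q ^+ i.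
  by apply: (mulfI qi0); rewrite -expr_bin2_sqr bi; ring.
have qni : q ^+ (n * i) = q ^+ (i * i) * q ^+ (i * N) by rewrite -exprD -mulnDr -eN mulnC.
have -> : (y * q ^+ l) ^+ i
    = q ^+ (n * i) / q ^+ i * a ^+ i * a ^+ i * (c * ga) ^+ i * q ^+ (l * i).
  rewrite (_ : y * q ^+ l = q ^+ n / q * a * a * (c * ga) * q ^+ l); last by rewrite /y; ring.
  by rewrite !(exprMn i) exprVn -!exprM.
rewrite (exprNn (c * ga)).
have cgi : (c * ga) ^+ i != 0 by rewrite expf_neq0.
have s0 : (-1) ^+ i != 0 :> F by rewrite expf_neq0 // oppr_eq0 oner_eq0.
have -> : a ^+ n = a ^+ i * a ^+ N by rewrite -exprD -eN.
have -> : (a * q ^+ i) ^+ N = a ^+ N * q ^+ (i * N) by rewrite exprMn -exprM.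
have -> : q ^+ ((l + n) * i) = q ^+ (l * i) * q ^+ (n * i) by rewrite -exprD mulnDl.
have qC0 : q ^+ 'C(i, 2) != 0 by rewrite expf_neq0.
have qiN0 : q ^+ (i * N) != 0 by rewrite expf_neq0.
rewrite bi qni qii.
move: (1 - a ^+ 2 / q) nx (1 - a ^+ 2 / q * _) => D D0 D'.
by field; nz.
Qed.

(** * The terminating q-Watson sum *)

(* The summand of Andrews' terminating q-Watson sum, b and d standing for a^2 and c^2. *)
Definition watson_term (F : fieldType) (q b d : F) n k :=
  qpoch (q ^- n) q k * qpoch (q ^+ n / q * (b * d)) q k * qpoch b (q ^+ 2) k
  / (qpoch q q k * qpoch b q k * qpoch (b * d) (q ^+ 2) k) * q ^+ k.

Lemma qpoch_sqr_neq0 (F : fieldType) (q x : F) n :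
  qpoch x q (n + n) != 0 -> qpoch x (q ^+ 2) n != 0.
Proof.
move/qpoch_neq0P => h; apply/qpoch_neq0P => k kn.
by rewrite -exprM mulSn mul1n; apply: h; natlia.
Qed.

(** Both sums are extended to k = n + 2, where the added terms vanish and so does the final value of
    the certificate. *)
Lemma watson_rec (F : fieldType) (q b d : F) n :
  q != 0 -> qpoch q q n.+2 != 0 -> qpoch b q n.+2 != 0 ->
  qpoch (b * d) q (n.+2 + n.+2) != 0 ->
  (1 - b * q ^+ n.+1) * (1 - b * d * q ^+ n) * \sum_(k < n.+3) watson_term q b d n.+2 k
  = b * (1 - d * q ^+ n) * (1 - q ^+ n.+1) * \sum_(k < n.+1) watson_term q b d n k.
Proof.
move=> q0 hq hb hbd; have hbd2 := qpoch_sqr_neq0 hbd.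
have -> : \sum_(k < n.+1) watson_term q b d n k = \sum_(k < n.+3) watson_term q b d n k.
  rewrite [RHS]big_ord_recr [X in _ = X + _]big_ord_recr /= /watson_term.
  by rewrite !qpoch_expVn // !mul0r !addr0.
apply/eqP; rewrite -subr_eq0 !mulr_sumr -sumrB; apply/eqP.
have qn0 : q ^+ n != 0 by rewrite expf_neq0.
have qn1 : 1 - q ^- n.+1 != 0.
  rewrite subr_eq0 eq_sym -invr1 (inj_eq invr_inj) exprS.
  by have := qpoch_neq0_last (ltnW (leqnn n.+2)) hq; rewrite subr_eq0 eq_sym.
have nbd : 1 - q ^+ n * (b * d) != 0.
  by rewrite mulrC; apply: qpoch_neq0_last hbd; natlia.
(* The certificate uses (q^-(n+1);q)_k and (q^n bd;q)_k, which lie between the factors for n + 2 and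
   those for n; hence the divisions by 1 - q^-(n+1) and 1 - q^n bd below. *)
pose P k := (1 - b * d * q ^+ n * q ^+ n.+1)
   * (qpoch (q ^- n.+1) q k * qpoch (q ^+ n * (b * d)) q k
   * qpoch b (q ^+ 2) k.+1 / (qpoch q q k * qpoch b q k * qpoch (b * d) (q ^+ 2) k)).
rewrite (partial_sums (P := P) (f := fun k =>
  (1 - b * q ^+ n.+1) * (1 - b * d * q ^+ n) * watson_term q b d n.+2 k
  - b * (1 - d * q ^+ n) * (1 - q ^+ n.+1) * watson_term q b d n k)).
- by rewrite /P qpoch_expVn // !(mul0r, mulr0).
- by rewrite /P /watson_term !qpochS !qpoch0 !exprS !expr0; field; nz.
move=> k kn.
have d1 : 1 - q * q ^+ k != 0 by apply: qpoch_neq0_last hq.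
have d2 : 1 - b * q ^+ k != 0 by apply: qpoch_neq0_last hb.
have d3 : 1 - b * d * (q ^+ 2) ^+ k != 0 by apply: qpoch_neq0_last hbd2.
have hqk : qpoch q q k != 0 by apply: qpoch_neq0_le hq; natlia.
have hbk : qpoch b q k != 0 by apply: qpoch_neq0_le hb; natlia.
have hdk : qpoch (b * d) (q ^+ 2) k != 0 by apply: qpoch_neq0_le hbd2; natlia.
pose K := qpoch (q ^- n.+1) q k * qpoch (q ^+ n * (b * d)) q k * qpoch b (q ^+ 2) k.+1
  / (qpoch q q k * qpoch b q k * qpoch (b * d) (q ^+ 2) k
    * ((1 - q * q ^+ k) * (1 - b * q ^+ k) * (1 - b * d * (q ^+ 2) ^+ k))).
have e1 : watson_term q b d n.+2 k.+1 = K * ((1 - q ^- n.+2)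
    * ((1 - q ^+ n * (b * d) * q ^+ k)
    * (1 - q ^+ n * (b * d) * q ^+ k.+1) / (1 - q ^+ n * (b * d))) * q ^+ k.+1).
  rewrite /watson_term (qpochSl (q ^- n.+2)).
  rewrite (_ : q ^- n.+2 * q = q ^- n.+1); last by rewrite (exprS _ n.+1) exprS; field; nz.
  rewrite (_ : q ^+ n.+2 / q * (b * d) = q ^+ n * (b * d) * q); last by rewrite !exprS; field; nz.
  have -> : qpoch (q ^+ n * (b * d) * q) q k.+1 = qpoch (q ^+ n * (b * d)) q k
     * (1 - q ^+ n * (b * d) * q ^+ k)
     * (1 - q ^+ n * (b * d) * q ^+ k.+1) / (1 - q ^+ n * (b * d)).
    by rewrite -!qpochS [in RHS]qpochSl [RHS]mulrC mulKf.
  rewrite /K (qpochS q) (qpochS b q) (qpochS (b * d)).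
  move: (1 - q * q ^+ k) (1 - b * q ^+ k) (1 - b * d * _) (1 - q ^+ n * (b * d))
    d1 d2 d3 nbd => ? ? ? ? *.
  by field; nz.
have e2 : watson_term q b d n k.+1
  = K * ((1 - q ^- n.+1 * q ^+ k) * (1 - q ^- n.+1 * q ^+ k.+1) / (1 - q ^- n.+1)
    * (1 - q ^+ n / q * (b * d)) * q ^+ k.+1).
  rewrite /watson_term (qpochSl (q ^+ n / q * (b * d))).
  rewrite (_ : q ^+ n / q * (b * d) * q = q ^+ n * (b * d)); last by field; nz.
  have -> : qpoch (q ^- n) q k.+1 = qpoch (q ^- n.+1) q k
     * (1 - q ^- n.+1 * q ^+ k) * (1 - q ^- n.+1 * q ^+ k.+1) / (1 - q ^- n.+1).
    rewrite -!qpochS [in RHS]qpochSl [RHS]mulrC mulKf //; congr (qpoch _ _ _).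
    by rewrite exprS; field; nz.
  rewrite /K (qpochS q) (qpochS b q) (qpochS (b * d)).
  move: (1 - q * q ^+ k) (1 - b * q ^+ k) (1 - b * d * _) (1 - q ^- n.+1)
    d1 d2 d3 qn1 => ? ? ? ? *.
  by field; nz.
have e3 : P k.+1 = (1 - b * d * q ^+ n * q ^+ n.+1) * (K * ((1 - q ^- n.+1 * q ^+ k)
    * (1 - q ^+ n * (b * d) * q ^+ k) * (1 - b * (q ^+ 2) ^+ k.+1))).
  rewrite /P /K (qpochS b (q ^+ 2) k.+1) (qpochS q) (qpochS b q) (qpochS (b * d))
    (qpochS (q ^- n.+1)) (qpochS (q ^+ n * (b * d))).
  move: (1 - q * q ^+ k) (1 - b * q ^+ k) (1 - b * d * (q ^+ 2) ^+ k) d1 d2 d3 => ? ? ? *.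
  by field; nz.
have e4 : P k = (1 - b * d * q ^+ n * q ^+ n.+1) * (K * ((1 - q * q ^+ k)
    * (1 - b * q ^+ k) * (1 - b * d * (q ^+ 2) ^+ k))).
  rewrite /P /K.
  move: (1 - q * q ^+ k) (1 - b * q ^+ k) (1 - b * d * (q ^+ 2) ^+ k) d1 d2 d3 => ? ? ? *.
  by field; nz.
rewrite e1 e2 e3 e4; clear e1 e2 e3 e4.
move: (K) => L; rewrite !exprS !expr0 !exprMn ?expr1n !mulr1.
move: qn1; rewrite exprS.
have qnq : 1 - q * q ^+ n != 0 by apply: qpoch_neq0_last hq.
move: (q ^+ n) (q ^+ k) qn0 nbd qnq => X Y X0 nbd qnq qn1.
have qnq1 : q * X - 1 != 0 by rewrite -opprB oppr_eq0.
by field; nz.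
Qed.

(** The recurrence leads down to n = 1, where the two terms cancel. *)
Lemma watson_odd (F : fieldType) (q b d : F) h :
  q != 0 -> qpoch q q h.*2.+1 != 0 -> qpoch b q h.*2.+1 != 0 ->
  qpoch (b * d) q (h.*2.+1 + h.*2.+1) != 0 ->
  \sum_(k < h.*2.+2) watson_term q b d h.*2.+1 k = 0.
Proof.
move=> q0; elim: h => [|h IHh] hq hb hbd.
  move: hq hb (qpoch_sqr_neq0 (n := 1) hbd).
  rewrite !big_ord_recr big_ord0 /= /watson_term !qpochS !qpoch0 !expr0 !expr1 !mul1r !mulr1.
  by move=> *; field; nz.
have hb1 : 1 - b * q ^+ h.*2.+2 != 0 by apply: qpoch_neq0_last hb; rewrite doubleS.
have hd1 : 1 - b * d * q ^+ h.*2.+1 != 0 by apply: qpoch_neq0_last hbd; natlia.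
apply: (mulfI (mulf_neq0 hb1 hd1)); rewrite mulr0 doubleS watson_rec // IHh ?mulr0 //.
- by apply: qpoch_neq0_le hq; natlia.
- by apply: qpoch_neq0_le hb; natlia.
- by apply: qpoch_neq0_le hbd; natlia.
Qed.

Lemma watson_even (F : fieldType) (q b d : F) h :
  q != 0 -> qpoch q q h.*2 != 0 -> qpoch b q h.*2 != 0 ->
  qpoch (b * d) q (h.*2 + h.*2) != 0 ->
  \sum_(k < h.*2.+1) watson_term q b d h.*2 k
  = b ^+ h * (qpoch d (q ^+ 2) h * qpoch q (q ^+ 2) h)
    / (qpoch (b * q) (q ^+ 2) h * qpoch (b * d) (q ^+ 2) h).
Proof.
move=> q0; elim: h => [|h IHh] hq hb hbd.
  by rewrite big_ord1 /watson_term !qpoch0 !expr0 !mulr1.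
have hb1 : 1 - b * q ^+ h.*2.+1 != 0 by apply: qpoch_neq0_last hb; rewrite doubleS.
have hd1 : 1 - b * d * q ^+ h.*2 != 0 by apply: qpoch_neq0_last hbd; natlia.
have hb2 : qpoch (b * q) (q ^+ 2) h != 0.
  apply/qpoch_neq0P => k kh; rewrite -mulrA -exprM -exprS.
  by move/qpoch_neq0P: hb; apply; natlia.
have hbd2 : qpoch (b * d) (q ^+ 2) h != 0.
  by apply: qpoch_sqr_neq0; apply: qpoch_neq0_le hbd; natlia.
apply: (mulfI (mulf_neq0 hb1 hd1)); rewrite doubleS watson_rec // IHh.
- rewrite !qpochS -!exprM (_ : 2 * h = h.*2)%N; last by natlia.
  have -> : b * q * q ^+ h.*2 = b * q ^+ h.*2.+1 by rewrite exprS mulrA.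
  have -> : q * q ^+ h.*2 = q ^+ h.*2.+1 by rewrite exprS.
  rewrite (exprS b); move: (1 - b * _) (1 - b * d * _) hb1 hd1 => ? ? *.
  by field; nz.
- by apply: qpoch_neq0_le hq; natlia.
- by apply: qpoch_neq0_le hb; natlia.
- by apply: qpoch_neq0_le hbd; natlia.
Qed.

(** * Matching the terms *)

Lemma qpoch_sqr (F : fieldType) (q x : F) n :
  qpoch x q n * qpoch (- x) q n = qpoch (x ^+ 2) (q ^+ 2) n.
Proof.
elim: n => [|n IHn]; first by rewrite !qpoch0 mulr1.
by rewrite !qpochS -IHn -exprM mulnC exprM; ring.
Qed.

Lemma qpoch_double (F : fieldType) (q x : F) h :
  qpoch x q h.*2 = qpoch x (q ^+ 2) h * qpoch (x * q) (q ^+ 2) h.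
Proof.
elim: h => [|h IHh]; first by rewrite !qpoch0 mulr1.
rewrite doubleS !qpochS IHh -!exprM -mul2n (exprS q (2 * h)).
by ring.
Qed.

(** For al = a and ga = c the transformed series has the pairs a, -a above and ac, -ac below. Each
    merges into one factorial of base q^2, which gives the q-Watson summand. *)
Lemma dixon_watson (F : fieldType) (q a c : F) n M :
  q != 0 -> a != 0 -> c != 0 -> qpoch q q n != 0 -> (n.+1.*2 <= M)%N ->
  nonres q M (a ^+ 2) -> nonres q M (c ^+ 2) -> nonres q M ((a * c) ^+ 2) ->
  phi_dixon q n a c a c
  = qpoch (a ^+ 2) q n * qpoch (a * c) q n / (qpoch a q n * qpoch c q n * a ^+ n)
    * \sum_(k < n.+1) watson_term q (a ^+ 2) (c ^+ 2) n k.
Proof.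
move=> q0 a0 c0 hq nM na nc nac.
have hac : qpoch (- (a * c)) q n != 0.
  by apply: (@nonres_qpoch_sqrt0 _ _ _ M); rewrite ?sqrrN //; natlia.
rewrite phi_dixon_sears -?expr2 //.
- congr (_ * _); apply: eq_bigr => k _; rewrite !qpochsE /watson_term.
  rewrite (_ : _ * _ * c = q ^+ n / q * (a ^+ 2 * c ^+ 2)); last by ring.
  rewrite -exprMn -!qpoch_sqr; congr (_ / _ * _); ring.
- by apply: nonres_qpoch_sqrt0 na _; natlia.
- by apply: nonres_qpoch_sqrt0 nc _; natlia.
- by apply: nonres_qpoch0 na _; natlia.
- by apply: nonres_qpoch_sqrt0 nac _; natlia.
Qed.

Lemma dixon_odd (F : fieldType) (q a c : F) h M (n := h.*2.+1) :
  q != 0 -> a != 0 -> c != 0 -> qpoch q q n != 0 -> (n.+1.*2 <= M)%N ->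
  nonres q M (a ^+ 2) -> nonres q M (c ^+ 2) -> nonres q M ((a * c) ^+ 2) ->
  phi_dixon q n a c a c = 0.
Proof.
move=> q0 a0 c0 hq nM na nc nac; rewrite (dixon_watson q0 a0 c0 hq nM na nc nac).
rewrite watson_odd ?mulr0 // -?exprMn.
  by apply: nonres_qpoch0 na _; rewrite -/n; natlia.
by apply: nonres_qpoch0 nac _; rewrite -/n; natlia.
Qed.

Lemma dixon_even (F : fieldType) (q a c : F) h M (n := h.*2) :
  q != 0 -> a != 0 -> c != 0 -> qpoch q q n != 0 -> (n.+1.*2 <= M)%N ->
  nonres q M (a ^+ 2) -> nonres q M (c ^+ 2) -> nonres q M ((a * c) ^+ 2) ->
  phi_dixon q n a c a c
  = qpoch (a ^+ 2) q n * qpoch (a * c) q n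
    * (qpoch (c ^+ 2) (q ^+ 2) h * qpoch q (q ^+ 2) h)
    / (qpoch a q n * qpoch c q n
       * (qpoch (a ^+ 2 * q) (q ^+ 2) h * qpoch ((a * c) ^+ 2) (q ^+ 2) h)).
Proof.
move=> q0 a0 c0 hq nM na nc nac; rewrite (dixon_watson q0 a0 c0 hq nM na nc nac).
have ha : qpoch (a ^+ 2) q n != 0 by apply: nonres_qpoch0 na _; natlia.
have hac : qpoch ((a * c) ^+ 2) q (n + n) != 0 by apply: nonres_qpoch0 nac _; natlia.
rewrite watson_even -?exprMn // -/n.
have -> : a ^+ n = (a ^+ 2) ^+ h by rewrite -exprM /n -mul2n.
have h1 : qpoch a q n != 0 by apply: nonres_qpoch_sqrt0 na _; natlia.
have h2 : qpoch c q n != 0 by apply: nonres_qpoch_sqrt0 nc _; natlia.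
have h3 : qpoch (a ^+ 2 * q) (q ^+ 2) h != 0.
  by move: ha; rewrite /n qpoch_double mulf_eq0 => /norP[].
have h4 : qpoch ((a * c) ^+ 2) (q ^+ 2) h != 0.
  by apply: qpoch_sqr_neq0; apply: qpoch_neq0_le hac; rewrite /n; natlia.
have h5 : (a ^+ 2) ^+ h != 0 by rewrite !expf_neq0.
by field; nz.
Qed.

Lemma qpoch_rev_div (F : fieldType) (q y : F) n j :
  q != 0 -> y != 0 -> (j <= n)%N -> qpoch y q (n - j) != 0 ->
  qpoch (q / q ^+ n / y) q j
  = qpoch y q n * q ^+ 'C(j.+1, 2) / (qpoch y q (n - j) * ((- y) ^+ j * q ^+ (n * j))).
Proof.
move=> q0 y0 jn hy; apply: (canRL (mulfK _)); last by rewrite mulrA qpoch_rev.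
by rewrite !mulf_neq0 ?expf_neq0 ?oppr_eq0.
Qed.

Lemma T_odd (F : fieldType) (q a c : F) l m n i j :
  odd (n - i - j) -> T q a c l m n i j = 0.
Proof.
by move=> o; rewrite /T; case: ifP => // _; rewrite /chi -signr_odd o /= expr1 subrr mul0r mulr0.
Qed.

(** Reversing every factorial with a negative power of q in its parameter, apart from (q^-l;q)_i and
    its like, expresses the term through [a1] and [c1], the parameters of the residual series with l
    = m = 0. The accompanying signs and powers cancel. *)
Lemma T_even (F : fieldType) (q a c : F) l m n i j h
    (N := (j + h.*2)%N) (a1 := a * q ^+ i) (c1 := c * q ^+ j) :
  (2%:R : F) != 0 -> n = (i + N)%N ->
  q != 0 -> a != 0 -> c != 0 ->
  1 - a ^+ 2 / q != 0 ->
  qpoch q q i != 0 -> qpoch (a ^+ 2 * q ^+ n) q i != 0 ->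
  qpoch (a ^+ 2 * q ^+ l) q i != 0 ->
  qpoch q q j != 0 -> qpoch (c ^+ 2 * q ^+ m) q j != 0 ->
  qpoch (c ^+ 2 / q * q ^+ j) q j != 0 ->
  qpoch (a1 ^+ 2) q N != 0 -> qpoch a1 q N != 0 -> qpoch (- a1) q N != 0 ->
  qpoch (a1 ^+ 2 * q ^+ h.*2) (q ^+ 2) h != 0 -> qpoch (c1 ^+ 2 * q) (q ^+ 2) h != 0 ->
  T q a c l m n i j =
    a ^+ i * q ^+ ((l + n) * i) * (1 - a ^+ 2 / q * q ^+ (i + i)) / (1 - a ^+ 2 / q)
    * (qpoch (a ^+ 2 / q) q i * qpoch (q ^- l) q i * qpoch (q ^- n) q i)
    / (qpoch q q i * qpoch (a ^+ 2 * q ^+ n) q i * qpoch (a ^+ 2 * q ^+ l) q i)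
    * (c ^+ j * q ^+ ((m + N) * j) * (qpoch (q ^- m) q j * qpoch (q ^- N) q j)
       * (qpoch c q j * qpoch (- c) q j)
       / (qpoch q q j * qpoch (c ^+ 2 * q ^+ m) q j * qpoch (c ^+ 2 / q * q ^+ j) q j))
    * (qpoch (a1 ^+ 2) q N * qpoch a1 q h.*2 * qpoch (- a1) q h.*2
       / (qpoch (a1 ^+ 2) q h.*2 * qpoch a1 q N * qpoch (- a1) q N))
    * (qpoch q (q ^+ 2) h * qpoch (a1 ^+ 2 * c1 ^+ 2 * q ^+ h.*2) (q ^+ 2) h
       / (qpoch (a1 ^+ 2 * q ^+ h.*2) (q ^+ 2) h * qpoch (c1 ^+ 2 * q) (q ^+ 2) h)).
Proof.
move=> n2 def_n q0 a0 c0 nD hqi hani hali hqj hcmj hcj ha1 ha1' ha1'' hY2 hqc.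
have eN : (n - i = N)%N by rewrite def_n addKn.
have eM : (n - i - j = h.*2)%N by rewrite eN addKn.
have jN : (j <= N)%N by rewrite leq_addr.
have NjM : (N - j = h.*2)%N by rewrite addKn.
rewrite /T ifT; last by natlia.
have chi1 : chi F (n - i - j) = 1.
  by rewrite /chi -signr_odd eM odd_double expr0 mulfV.
rewrite chi1 mulr1 eM doubleK eN !qpochsE.
have qn0 k : q ^+ k != 0 by rewrite expf_neq0.
have q1z k : q ^ (1 - k%:Z) = q / q ^+ k by rewrite expfzDr // expr1z -exprnN.
have -> : (l%:Z + n%:Z) * i%:Z + (m%:Z + n%:Z - i%:Z) * j%:Z - 'C(j, 2)%:Z
   = ((l + n) * i + (m + N) * j)%:Z - 'C(j, 2)%:Z.
  by rewrite def_n !PoszD !PoszM !PoszD; ring.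
rewrite expfzDr // -exprnN -exprnP exprD.
have -> : q ^ (2 * i%:Z - 1) * a ^+ 2 = a ^+ 2 / q * q ^+ (i + i).
  rewrite expfzDr // -exprN1 (_ : 2 * i%:Z = (i + i)%:Z) -?exprnP; last by rewrite PoszD; ring.
  by ring.
rewrite (mulrC q^-1).
have -> : q ^ (i%:Z - n%:Z) = q ^- N.
  by rewrite exprnN; congr (_ ^ _); rewrite def_n PoszD; ring.
have -> : q ^ (1 - n%:Z - i%:Z) / a ^+ 2 = q / q ^+ N / a1 ^+ 2.
  rewrite (_ : 1 - n%:Z - i%:Z = 1 - (N + (i + i))%:Z) ?q1z; last by rewrite def_n !PoszD; ring.
  by rewrite /a1 !exprD; field; nz.
have r1 : q ^ (1 - n%:Z) / a = q / q ^+ N / a1.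
  by rewrite q1z def_n /a1 exprD; field; nz.
have r2 : - q ^ (1 - n%:Z) / a = q / q ^+ N / (- a1).
  by rewrite mulNr r1 invrN mulrN.
rewrite r1 r2.
have -> : q ^ (j%:Z - 1) * c ^+ 2 = c ^+ 2 / q * q ^+ j.
  by rewrite expfzDr // -exprN1 -exprnP; ring.
have -> : q ^+ (1 + 2 * j) * c ^+ 2 = c1 ^+ 2 * q.
  by rewrite /c1 exprD expr1 mulnC exprM; ring.
(* Since n = i + j + 2h, the two base q^2 factorials with negative exponents are complete reversals
   of (Y1;q^2)_h and (Y2;q^2)_h. *)
pose Y1 := a1 ^+ 2 * c1 ^+ 2 * q ^+ h.*2; pose Y2 := a1 ^+ 2 * q ^+ h.*2.
have q2n : q ^ (2 - 2 * n%:Z) = q ^+ 2 / q ^+ (n + n).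
  by rewrite expfzDr // exprnP exprnN; congr (_ * q ^ _); rewrite PoszD; ring.
have eqn : q ^+ n = q ^+ i * (q ^+ j * q ^+ h.*2) by rewrite def_n !exprD.
have q2h : (q ^+ 2) ^+ h = q ^+ h.*2 by rewrite -exprM mul2n.
have -> : q ^ (2 - 2 * n%:Z) / (a ^+ 2 * c ^+ 2) = q ^+ 2 / (q ^+ 2) ^+ h / Y1.
  by rewrite q2n exprD eqn q2h /Y1 /a1 /c1; field; nz.
have -> : q ^ (2 - 2 * n%:Z + 2 * j%:Z) / a ^+ 2 = q ^+ 2 / (q ^+ 2) ^+ h / Y2.
  rewrite expfzDr // q2n (_ : 2 * j%:Z = (j + j)%:Z) -?exprnP; last by rewrite PoszD; ring.
  by rewrite !exprD eqn q2h /Y2 /a1; field; nz.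
have hM2 : qpoch (a1 ^+ 2) q h.*2 != 0 by apply: qpoch_neq0_le ha1; rewrite leq_addl.
have hM : qpoch a1 q h.*2 != 0 by apply: qpoch_neq0_le ha1'; rewrite leq_addl.
have hM' : qpoch (- a1) q h.*2 != 0 by apply: qpoch_neq0_le ha1''; rewrite leq_addl.
have a1_0 : a1 != 0 by rewrite mulf_neq0.
have c1_0 : c1 != 0 by rewrite mulf_neq0.
have a12_0 : a1 ^+ 2 != 0 by rewrite expf_neq0.
have na1_0 : - a1 != 0 by rewrite oppr_eq0.
have Y2_0 : Y2 != 0 by rewrite /Y2 mulf_neq0.
have Y1_0 : Y1 != 0 by rewrite /Y1 !mulf_neq0 // expf_neq0.
have q20 : q ^+ 2 != 0 by rewrite expf_neq0.
rewrite (qpoch_rev_div q0 a12_0 jN) ?NjM // (qpoch_rev_div q0 a1_0 jN) ?NjM //.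
rewrite (qpoch_rev_div q0 na1_0 jN) ?NjM // opprK.
rewrite (qpoch_rev_div q20 Y1_0 (leqnn h)) ?subnn ?qpoch0 ?oner_eq0 //.
rewrite (qpoch_rev_div q20 Y2_0 (leqnn h)) ?subnn ?qpoch0 ?oner_eq0 //.
rewrite -/Y1 -/Y2 -/Y2 in hY2 *.
have -> : (- (a1 ^+ 2)) ^+ j = (- a1) ^+ j * a1 ^+ j by rewrite -exprMn; congr (_ ^+ _); ring.
(* The ratio Y1/Y2 = c1^2 cancels the surplus c^(2h) in c^N. *)
have -> : (- Y1) ^+ h = (- Y2) ^+ h * (c ^+ h.*2 * q ^+ (j * h.*2)).
  rewrite exprM -exprMn -/c1 -mul2n (exprM c1) -exprMn; congr (_ ^+ _).
  by rewrite /Y1 /Y2; ring.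
have -> : c ^+ N = c ^+ j * c ^+ h.*2 by rewrite -exprD.
have bj : q ^+ 'C(j.+1, 2) = q ^+ 'C(j, 2) * q ^+ j by rewrite binS bin1 exprD.
have qjj : q ^+ (j * j) = q ^+ 'C(j, 2) * q ^+ 'C(j, 2) * q ^+ j.
  by apply: (mulfI (qn0 j)); rewrite -expr_bin2_sqr bj; ring.
have -> : q ^+ (N * j) = q ^+ (j * j) * q ^+ (j * h.*2) by rewrite -exprD -mulnDr mulnC.
rewrite bj qjj (mulrC (q ^+ n)) (mulrC (q ^+ l)) (mulrC (q ^+ m)).
have p1 : (- a1) ^+ j != 0 by rewrite expf_neq0.
have p2 : a1 ^+ j != 0 by rewrite expf_neq0.
have p3 : (- Y2) ^+ h != 0 by rewrite expf_neq0 // oppr_eq0.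
have p4 : c ^+ h.*2 != 0 by rewrite expf_neq0.
have p5 : (q ^+ 2) ^+ 'C(h.+1, 2) != 0 by rewrite !expf_neq0.
have p6 : (q ^+ 2) ^+ (h * h) != 0 by rewrite !expf_neq0.
have p7 := qn0 'C(j, 2); have p8 := qn0 j; have p9 := qn0 (j * h.*2)%N.
move: (1 - a ^+ 2 / q) nD (1 - a ^+ 2 / q * _) => D nD D'.
by field; nz.
Qed.

(** * The double sum for generic parameters *)

Lemma subr1_div_neq0 (F : fieldType) (q x : F) : q != 0 -> x != q -> 1 - x / q != 0.
Proof.
move=> q0; apply: contra_neq => /subr0_eq /esym/(canRL (mulfVK q0)).
by rewrite mul1r.
Qed.

Lemma qpoch_swap (F : fieldType) (q x : F) k n : qpoch x q k != 0 ->
  qpoch (x * q ^+ k) q n = qpoch x q n * qpoch (x * q ^+ n) q k / qpoch x q k.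
Proof. by move=> h; apply: (canRL (mulfK h)); rewrite mulrC -!qpochD addnC. Qed.

Definition dixon_pref (F : fieldType) (q a c : F) l m n :=
  qpochs [:: a; q ^+ n * a ^+ 2] q l / qpochs [:: a ^+ 2; q ^+ n * a] q l
  * (qpochs [:: - a; q ^+ m * c ^+ 2] q n / qpochs [:: - (a * c); q ^+ m * c] q n).

(** For odd N - j both sides vanish, the left by the q-Watson sum and the right by [chi]. For even N
    - j both are products, whose factorials are split at i and j into common pieces. In the second
    coefficient c and a q^i have exchanged roles. *)
Lemma dixon_term (F : fieldType) (q a c : F) l m n i j (N := (n - i)%N)
    (M := (l + m + n).+1.*2) :
  (2%:R : F) != 0 -> (i + j <= n)%N ->
  q != 0 -> a != 0 -> c != 0 -> qpoch q q n != 0 ->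
  nonres q M (a ^+ 2) -> nonres q M (c ^+ 2) -> nonres q M ((a * c) ^+ 2) ->
  dixon_coef q l n a c (c * q ^+ m) i
  * (dixon_coef q m N c (a * q ^+ i) (a * q ^+ i) j
     * phi_dixon q (N - j) (a * q ^+ i) (c * q ^+ j) (a * q ^+ i) (c * q ^+ j))
  = dixon_pref q a c l m n * T q a c l m n i j.
Proof.
move=> n2 ijn q0 a0 c0 hq na nc nac.
set a1 := a * q ^+ i; set c1 := c * q ^+ j.
have qn0 k : q ^+ k != 0 by rewrite expf_neq0.
have a1_0 : a1 != 0 by rewrite mulf_neq0.
have c1_0 : c1 != 0 by rewrite mulf_neq0.
have na1 : nonres q (M - i.*2) (a1 ^+ 2).
  by rewrite /a1 exprMn -exprM muln2; apply: nonres_shift.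
have nc1 : nonres q (M - j.*2) (c1 ^+ 2).
  by rewrite /c1 exprMn -exprM muln2; apply: nonres_shift.
have nac1 : nonres q (M - (i + j).*2) ((a1 * c1) ^+ 2).
  have -> : (a1 * c1) ^+ 2 = (a * c) ^+ 2 * q ^+ (i + j).*2.
    by rewrite /a1 /c1 -mul2n mulnC exprM exprD; ring.
  exact: nonres_shift.
have jN : (j <= N)%N by rewrite /N; natlia.
have hqNj : qpoch q q (N - j) != 0 by apply: qpoch_neq0_le hq; rewrite /N; natlia.
have bM : ((N - j).+1.*2 <= M - (i + j).*2)%N by rewrite /M /N; natlia.
have na1' : nonres q (M - (i + j).*2) (a1 ^+ 2) by apply: nonres_le na1; natlia.
have nc1' : nonres q (M - (i + j).*2) (c1 ^+ 2) by apply: nonres_le nc1; natlia.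
have [h eM] : exists h, (N - j = odd (N - j) + h.*2)%N.
  by exists (N - j)./2; rewrite odd_double_half.
case o : (odd (N - j)) eM => /= eM.
  rewrite T_odd // mulr0 eM (dixon_odd (M := (M - (i + j).*2)%N)) ?mulr0 //; last 2 first.
  - by move: hqNj; rewrite eM.
  - by move: bM; rewrite eM.
rewrite add0n in eM; have eN : N = (j + h.*2)%N by rewrite -eM subnKC.
have def_n : n = (i + N)%N by rewrite /N; natlia.
have iN : (i <= n)%N by natlia.
rewrite eM (dixon_even (M := (M - (i + j).*2)%N)) -?eM // eM.
have D0 : 1 - a ^+ 2 / q != 0.
  by apply: subr1_div_neq0 => //; have := na 0%N isT; rewrite mulr1.
have D1 : 1 - c ^+ 2 / q != 0.
  by apply: subr1_div_neq0 => //; have := nc 0%N isT; rewrite mulr1.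
have nac2 z k : ((z + k).*2 <= M)%N -> qpoch (- (a * c) * q ^+ z) q k != 0.
  by apply: nonres_qpoch_sqrt; rewrite sqrrN.
have hqi : qpoch q q i != 0 by apply: qpoch_neq0_le hq; natlia.
have hqj : qpoch q q j != 0 by apply: qpoch_neq0_le hq; natlia.
have hani : qpoch (a ^+ 2 * q ^+ n) q i != 0 by apply: nonres_qpoch na _; natlia.
have hali : qpoch (a ^+ 2 * q ^+ l) q i != 0 by apply: nonres_qpoch na _; natlia.
have hcmj : qpoch (c ^+ 2 * q ^+ m) q j != 0 by apply: nonres_qpoch nc _; natlia.
have hc2j : qpoch (c ^+ 2) q (j + j) != 0 by apply: nonres_qpoch0 nc _; natlia.
have D2 : 1 - c ^+ 2 / q * q ^+ (j + j) != 0.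
  by rewrite mulrAC; apply: subr1_div_neq0 => //; apply: nc; natlia.
(* Two ways of factoring (c^2/q;q)_(2j+1). They link the very-well-poised factor of the second
   expansion with (q^(j-1) c^2;q)_j in [T]. *)
have hcc : qpoch (c ^+ 2 / q) q j * (1 - c ^+ 2 / q * q ^+ (j + j))
     * qpoch (c ^+ 2 / q * q ^+ j) q j
   = (1 - c ^+ 2 / q) * qpoch (c ^+ 2) q (j + j).
  by rewrite mulrAC -qpochD -qpochS qpochSl mulfVK.
have hcj : qpoch (c ^+ 2 / q * q ^+ j) q j != 0.
  have : (1 - c ^+ 2 / q) * qpoch (c ^+ 2) q (j + j) != 0 by rewrite mulf_neq0.
  by rewrite -hcc mulf_eq0 => /norP[].
have ha1N2 : qpoch (a1 ^+ 2) q N != 0 by apply: nonres_qpoch0 na1 _; natlia.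
have ha1N : qpoch a1 q N != 0 by apply: nonres_qpoch_sqrt0 na1 _; natlia.
have ha1N' : qpoch (- a1) q N != 0.
  by apply: (@nonres_qpoch_sqrt0 _ _ _ (M - i.*2)); rewrite ?sqrrN //; natlia.
have ha1M2 : qpoch (a1 ^+ 2) q h.*2 != 0 by apply: nonres_qpoch0 na1 _; natlia.
have ha1M : qpoch a1 q h.*2 != 0 by apply: nonres_qpoch_sqrt0 na1 _; natlia.
have ha1M' : qpoch (- a1) q h.*2 != 0.
  by apply: (@nonres_qpoch_sqrt0 _ _ _ (M - i.*2)); rewrite ?sqrrN //; natlia.
have q2h : (q ^+ 2) ^+ h = q ^+ h.*2 by rewrite -exprM mul2n.
(* Bases q and q^2 are linked in two ways: by (x, -x; q)_2h = (x^2; q^2)_2h, cut in the middle, and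
   by separating even and odd factors of (x^2; q)_2h. *)
have sqa1 : qpoch a1 q h.*2 * qpoch (- a1) q h.*2
   = qpoch (a1 ^+ 2) (q ^+ 2) h * qpoch (a1 ^+ 2 * q ^+ h.*2) (q ^+ 2) h.
  by rewrite qpoch_sqr -addnn qpochD q2h addnn.
have dba1 := qpoch_double q (a1 ^+ 2) h.
have hY2 : qpoch (a1 ^+ 2 * q ^+ h.*2) (q ^+ 2) h != 0.
  have : qpoch a1 q h.*2 * qpoch (- a1) q h.*2 != 0 by rewrite mulf_neq0.
  by rewrite sqa1 mulf_eq0 => /norP[].
have [ha1p ha1qp] : qpoch (a1 ^+ 2) (q ^+ 2) h != 0 /\ qpoch (a1 ^+ 2 * q) (q ^+ 2) h != 0.
  by move: ha1M2; rewrite dba1 mulf_eq0 => /norP[].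
have hc1M2 : qpoch (c1 ^+ 2) q h.*2 != 0 by apply: nonres_qpoch0 nc1 _; natlia.
have dbc1 := qpoch_double q (c1 ^+ 2) h.
have [hc1p hc1qp] : qpoch (c1 ^+ 2) (q ^+ 2) h != 0 /\ qpoch (c1 ^+ 2 * q) (q ^+ 2) h != 0.
  by move: hc1M2; rewrite dbc1 mulf_eq0 => /norP[].
rewrite (@T_even _ _ _ _ _ _ _ _ _ h) -?eN //.
rewrite -/a1 -/c1.
have hac1 : qpoch (a1 * c1) q h.*2 != 0 by apply: nonres_qpoch_sqrt0 nac1 _; natlia.
have hac1' : qpoch (- (a1 * c1)) q h.*2 != 0.
  by apply: (@nonres_qpoch_sqrt0 _ _ _ (M - (i + j).*2)); rewrite ?sqrrN //; natlia.
have sqac : qpoch (a1 * c1) q h.*2 * qpoch (- (a1 * c1)) q h.*2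
   = qpoch ((a1 * c1) ^+ 2) (q ^+ 2) h * qpoch (a1 ^+ 2 * c1 ^+ 2 * q ^+ h.*2) (q ^+ 2) h.
  by rewrite qpoch_sqr -addnn qpochD q2h exprMn addnn.
have hacp : qpoch ((a1 * c1) ^+ 2) (q ^+ 2) h != 0.
  have : qpoch (a1 * c1) q h.*2 * qpoch (- (a1 * c1)) q h.*2 != 0 by rewrite mulf_neq0.
  by rewrite sqac mulf_eq0 => /norP[].
have hcgN : qpoch (c ^+ 2 * q ^+ m) q N != 0 by apply: nonres_qpoch nc _; natlia.
have hcgn : qpoch (c ^+ 2 * q ^+ m) q n != 0 by apply: nonres_qpoch nc _; natlia.
have hgN : qpoch (c * q ^+ m) q N != 0 by apply: nonres_qpoch_sqrt nc _; natlia.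
have hgn : qpoch (c * q ^+ m) q n != 0 by apply: nonres_qpoch_sqrt nc _; natlia.
have hal : qpoch a q l != 0 by apply: nonres_qpoch_sqrt0 na _; natlia.
have han : qpoch a q n != 0 by apply: nonres_qpoch_sqrt0 na _; natlia.
have hanl : qpoch (a * q ^+ n) q l != 0 by apply: nonres_qpoch_sqrt na _; natlia.
have ha2l : qpoch (a ^+ 2) q l != 0 by apply: nonres_qpoch0 na _; natlia.
have ha2n : qpoch (a ^+ 2) q n != 0 by apply: nonres_qpoch0 na _; natlia.
have ha2nl : qpoch (a ^+ 2 * q ^+ n) q l != 0 by apply: nonres_qpoch na _; natlia.
have hc1M : qpoch c1 q h.*2 != 0 by apply: nonres_qpoch_sqrt0 nc1 _; natlia.
have haci : qpoch (- (a * c)) q i != 0.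
  by rewrite -[X in qpoch X]mulr1 -(expr0 q) nac2 //; natlia.
have hacj : qpoch (- (a1 * c)) q j != 0.
  by rewrite /a1 mulrAC -mulNr nac2 //; natlia.
rewrite /dixon_pref /dixon_coef !qpochsE -/N eM
  (mulrC (q ^+ n)) (mulrC (q ^+ m)) (mulrC (q ^+ n)).
rewrite (mulrC (q ^+ m) c) !(mulrA c c) -!expr2 (mulrC c a1).
have eND : (N + j = j + j + h.*2)%N by rewrite eN; natlia.
have c1E : c ^+ 2 * q ^+ (j + j) = c1 ^+ 2 by rewrite /c1 exprD; ring.
rewrite eND (qpochD (c ^+ 2) q (j + j)) c1E dbc1.
(* The coefficient carries (a^2 q^l;q)_n and (a q^l;q)_n, the prefactor (a^2 q^n;q)_l and (a
   q^n;q)_l; exchanging l and n reconciles them. *)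
rewrite (qpoch_swap n ha2l) (qpoch_swap n hal) (qpochD (a ^+ 2) q n i).
have acE : qpoch (- (a * c)) q n
    = qpoch (- (a * c)) q i * qpoch (- (a1 * c)) q j * qpoch (- (a1 * c1)) q h.*2.
  rewrite (qpoch_split _ _ iN) -/N eN qpochD mulrA /c1 /a1.
  by congr (_ * qpoch _ _ _ * qpoch _ _ _); ring.
have naE : qpoch (- a) q n = qpoch (- a) q i * qpoch (- a1) q N.
  by rewrite (qpoch_split _ _ iN) -/N mulNr.
have cE : qpoch c q N = qpoch c q j * qpoch c1 q h.*2 by rewrite eN qpochD.
have accE : qpoch (a1 * c1) q h.*2 = qpoch ((a1 * c1) ^+ 2) (q ^+ 2) h
     * qpoch (a1 ^+ 2 * c1 ^+ 2 * q ^+ h.*2) (q ^+ 2) h / qpoch (- (a1 * c1)) q h.*2.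
  by apply: (canRL (mulfK hac1')).
have aaE : qpoch (- a1) q h.*2 = qpoch (a1 ^+ 2) (q ^+ 2) h
     * qpoch (a1 ^+ 2 * q ^+ h.*2) (q ^+ 2) h / qpoch a1 q h.*2.
  by apply: (canRL (mulfK ha1M)); rewrite mulrC.
have ccE : qpoch (c ^+ 2 / q) q j = (1 - c ^+ 2 / q) * qpoch (c ^+ 2) q (j + j)
    / (qpoch (c ^+ 2 / q * q ^+ j) q j * (1 - c ^+ 2 / q * q ^+ (j + j))).
  by apply: (canRL (mulfK _)); [rewrite mulf_neq0 | rewrite -hcc; ring].
rewrite acE naE cE accE aaE ccE dba1.
move: (1 - a ^+ 2 / q) D0 (1 - a ^+ 2 / q * _) (1 - c ^+ 2 / q) D1 (1 - c ^+ 2 / q * _) D2.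
move: (q ^+ ((l + n) * i)) (q ^+ ((m + N) * j)) (a ^+ i) (c ^+ j).
clear - hqi hqj hani hali hcmj hc2j hcj ha1N2 ha1N ha1N' ha1M ha1p ha1qp hY2 hc1p hc1qp
  hacp hac1' hcgN hcgn hgN hgn hal han hanl ha2l ha2n ha2nl hc1M haci hacj.
by move=> x1 x2 x3 x4 D D0 D' D1 nD1 D2 nD2; field; nz.
Qed.

(** The expansions run over i up to n and j up to n - i, the theorem over i up to l and j up to m.
    Terms beyond the smaller bound vanish, so the ranges can be exchanged. *)
Lemma sum_ord_support (V : nmodType) (f : nat -> V) m n :
  (forall i, (minn m n < i)%N -> f i = 0) ->
  \sum_(i < m.+1) f i = \sum_(i < n.+1) f i.
Proof.
wlog mn : m n / (m <= n)%N => [hw f0|/[!minn_idPl mn] f0].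
  by case: (leqP m n) => [/hw|/ltnW/hw e]; [apply | rewrite e // => i; rewrite minnC; apply: f0].
rewrite -!(big_mkord xpredT f) (@big_cat_nat _ _ _ m.+1 0 n.+1) //=.
rewrite [X in _ + X]big_nat_cond [X in _ + X]big1 ?addr0 // => i /andP[/andP[mi _] _].
exact: f0.
Qed.

Lemma T_eq0_l (F : fieldType) (q a c : F) l m n i j :
  q != 0 -> (l < i)%N -> T q a c l m n i j = 0.
Proof.
by move=> q0 li; rewrite /T !qpochsE (qpoch_expVn q0 li) !(mul0r, mulr0) if_same.
Qed.

Lemma T_eq0_m (F : fieldType) (q a c : F) l m n i j :
  q != 0 -> (m < j)%N -> T q a c l m n i j = 0.
Proof.
by move=> q0 mj; rewrite /T !qpochsE (qpoch_expVn q0 mj) !(mul0r, mulr0) if_same.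
Qed.

Lemma dixon_double_sum (F : fieldType) (q a c : F) l m n (M := (l + m + n).+1.*2) :
  (2%:R : F) != 0 -> q != 0 -> a != 0 -> c != 0 -> qpoch q q n != 0 ->
  nonres q M (a ^+ 2) -> nonres q M (c ^+ 2) -> nonres q M ((a * c) ^+ 2) ->
  phi_dixon q n a c (a * q ^+ l) (c * q ^+ m)
  = dixon_pref q a c l m n * \sum_(i < l.+1) \sum_(j < m.+1) T q a c l m n i j.
Proof.
move=> n2 q0 a0 c0 hq na nc nac; rewrite dixon_expand //.
rewrite -(@sum_ord_support _ (fun i => \sum_(j < m.+1) T q a c l m n i j) n) => [|i]; last first.
  rewrite gtn_min => /orP ni; apply: big1 => j _; case: ni => [ni|li]; last exact: T_eq0_l.
  by rewrite /T ifF //; natlia.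
rewrite mulr_sumr; apply: eq_bigr => i _; have iN : (i <= n)%N by rewrite -ltnS.
rewrite -(@sum_ord_support _ (fun j => T q a c l m n i j) (n - i)) => [|j]; last first.
  rewrite gtn_min => /orP [nj|mj]; last exact: T_eq0_m.
  by rewrite /T ifF //; natlia.
have na1 : nonres q (m + 0 + (n - i)).+1.*2 ((a * q ^+ i) ^+ 2).
  rewrite exprMn -exprM muln2; by apply: nonres_le (nonres_shift (j := i.*2) na); rewrite /M; natlia.
have nca1 : nonres q (m + 0 + (n - i)).+1.*2 ((c * (a * q ^+ i)) ^+ 2).
  have -> : (c * (a * q ^+ i)) ^+ 2 = (a * c) ^+ 2 * q ^+ i.*2.
    by rewrite -muln2 exprM; ring.
  by apply: nonres_le (nonres_shift (j := i.*2) nac); rewrite /M; natlia.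
have a1_0 : a * q ^+ i != 0 by rewrite mulf_neq0 ?expf_neq0.
(* Second expansion, now with c, m in place of a, l. Writing a q^i as a q^i q^0 makes it the case
   where the other index is 0. *)
rewrite phi_dixonC -[X in phi_dixon _ _ _ _ _ X]mulr1 -(expr0 q) dixon_expand //.
- rewrite !mulr_sumr; apply: eq_bigr => j _; have jN : (j <= n - i)%N by rewrite -ltnS.
  by rewrite expr0 mulr1 phi_dixonC dixon_term //; natlia.
- by apply: qpoch_neq0_le hq; natlia.
- by apply: nonres_le nc; rewrite /M; natlia.
Qed.

(** * Extension to all admissible parameters *)

(** Rational and regular at 0. The equation is demanded only off the zeros of r, so the default
    value of an inverse at a pole elsewhere is harmless; as r does not vanish at 0, it does hold at
    0. *)
Definition rat_at0 (F : fieldType) (f : F -> F) :=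
  exists p r : {poly F}, r.[0] != 0 /\ forall t, r.[t] != 0 -> f t = p.[t] / r.[t].

Lemma rat_at0_cst (F : fieldType) (x : F) : rat_at0 (fun _ : F => x).
Proof. by exists x%:P, 1; rewrite hornerC oner_eq0; split=> // t _; rewrite !hornerC divr1. Qed.

Lemma rat_at0_id (F : fieldType) : rat_at0 (fun t : F => t).
Proof. by exists 'X, 1; rewrite hornerC oner_eq0; split=> // t _; rewrite hornerX hornerC divr1. Qed.

Lemma rat_at0_add (F : fieldType) (f g : F -> F) :
  rat_at0 f -> rat_at0 g -> rat_at0 (fun t => f t + g t).
Proof.
move=> [p [r [r0 fE]]] [p' [r' [r0' gE]]]; exists (p * r' + p' * r), (r * r').
split=> [|t]; rewrite hornerM; first by rewrite mulf_neq0.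
rewrite mulf_eq0 => /norP[rt rt'].
by rewrite !hornerE fE // gE // addf_div.
Qed.

Lemma rat_at0_opp (F : fieldType) (f : F -> F) : rat_at0 f -> rat_at0 (fun t => - f t).
Proof.
move=> [p [r [r0 fE]]]; exists (- p), r; split=> // t rt.
by rewrite hornerN mulNr fE.
Qed.

Lemma rat_at0_mul (F : fieldType) (f g : F -> F) :
  rat_at0 f -> rat_at0 g -> rat_at0 (fun t => f t * g t).
Proof.
move=> [p [r [r0 fE]]] [p' [r' [r0' gE]]]; exists (p * p'), (r * r').
split=> [|t]; rewrite hornerM; first by rewrite mulf_neq0.
rewrite mulf_eq0 => /norP[rt rt'].
by rewrite hornerM fE // gE // mulf_div.
Qed.

(** The quotient r/p is expanded by r so that a nonzero denominator p r guarantees that p and r are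
    both nonzero. *)
Lemma rat_at0_inv (F : fieldType) (f : F -> F) :
  rat_at0 f -> f 0 != 0 -> rat_at0 (fun t => (f t)^-1).
Proof.
move=> [p [r [r0 fE]]]; rewrite fE // mulf_eq0 => /norP[p0 _].
exists (r * r), (p * r); split=> [|t]; rewrite hornerM; first by rewrite mulf_neq0.
rewrite mulf_eq0 => /norP[pt rt].
by rewrite hornerM fE // invf_div -[in RHS]mulf_div divff // mulr1.
Qed.

Lemma rat_at0_exp (F : fieldType) (f : F -> F) k :
  rat_at0 f -> rat_at0 (fun t => f t ^+ k).
Proof.
move=> hf; elim: k => [|k IHk]; first exact: (rat_at0_cst (1 : F)).
have [p [r [r0 e]]] := rat_at0_mul hf IHk; exists p, r; split=> // t rt.
by rewrite exprS e.
Qed.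

Lemma rat_at0_sum (F : fieldType) (I : Type) (s : seq I) (f : I -> F -> F) :
  (forall i, rat_at0 (f i)) -> rat_at0 (fun t => \sum_(i <- s) f i t).
Proof.
move=> hf; elim: s => [|i s IHs].
  have [p [r [r0 e]]] := rat_at0_cst (0 : F); exists p, r; split=> // t rt.
  by rewrite big_nil -e.
have [p [r [r0 e]]] := rat_at0_add (hf i) IHs.
by exists p, r; split=> // t rt; rewrite big_cons /= e.
Qed.

Lemma rat_at0_qpoch (F : fieldType) (f : F -> F) q k :
  rat_at0 f -> rat_at0 (fun t => qpoch (f t) q k).
Proof.
move=> hf; elim: k => [|k IHk].
  have [p [r [r0 e]]] := rat_at0_cst (1 : F); exists p, r; split=> // t rt.
  by rewrite qpoch0 -e.
have hx := rat_at0_opp (rat_at0_mul hf (rat_at0_cst (q ^+ k))).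
have [p [r [r0 e]]] := rat_at0_mul IHk (rat_at0_add (rat_at0_cst 1) hx).
by exists p, r; split=> // t rt; rewrite qpochS e.
Qed.

Lemma rat_at0_qpochs_nil (F : fieldType) (q : F) k : rat_at0 (fun _ : F => qpochs [::] q k).
Proof. exact: rat_at0_cst. Qed.

Lemma rat_at0_qpochs_cons (F : fieldType) (f : F -> F) (s : F -> seq F) q k :
  rat_at0 f -> rat_at0 (fun t => qpochs (s t) q k) ->
  rat_at0 (fun t => qpochs (f t :: s t) q k).
Proof.
move=> hf hs; have [p [r [r0 e]]] := rat_at0_mul (rat_at0_qpoch q k hf) hs.
by exists p, r; split=> // t rt; rewrite qpochs_cons e.
Qed.

(** Exceptional sets are given as zeros of a nonzero polynomial: conjunction is then a product, and
    the polynomial can be multiplied into the final identity. *)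
Definition cofin (F : fieldType) (P : F -> Prop) :=
  exists2 b : {poly F}, b != 0 & forall t, b.[t] != 0 -> P t.

Lemma cofinI (F : fieldType) (P Q : F -> Prop) :
  cofin P -> cofin Q -> cofin (fun t => P t /\ Q t).
Proof.
move=> [b b0 hb] [b' b0' hb']; exists (b * b'); first by rewrite mulf_neq0.
by move=> t; rewrite hornerM mulf_eq0 => /norP[/hb ? /hb' ?].
Qed.

Lemma cofin_forall (F : fieldType) (P : nat -> F -> Prop) k :
  (forall z, cofin (P z)) -> cofin (fun t => forall z, (z < k)%N -> P z t).
Proof.
move=> hP; elim: k => [|k [b b0 hb]]; first by exists 1; rewrite ?oner_neq0.
have [b' b0' hb'] := hP k; exists (b * b'); first by rewrite mulf_neq0.
move=> t; rewrite hornerM mulf_eq0 => /norP[/hb h /hb' h'] z.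
by rewrite ltnS leq_eqVlt => /orP[/eqP -> | /h].
Qed.

Lemma cofin_poly (F : fieldType) (p : {poly F}) x :
  p.[x] != 0 -> cofin (fun t => p.[t] != 0).
Proof. by move=> px; exists p => //; apply: contra_neq px => ->; rewrite horner0. Qed.

(** In characteristic zero the images of 0, 1, 2, ... are distinct, which supplies more roots than
    the degree allows. *)
Lemma poly_fun0 (F : numFieldType) (p : {poly F}) : (forall x, p.[x] = 0) -> p = 0.
Proof.
move=> h; apply: (@roots_geq_poly_eq0 _ _ [seq k%:R | k <- iota 0 (size p)]).
- by apply/allP => x _; apply/eqP.
- by rewrite map_inj_uniq ?iota_uniq // => x y /eqP; rewrite eqr_nat => /eqP.
- by rewrite size_map size_iota.
Qed.

(** The cross-multiplied difference times all denominators and the exceptional polynomial vanishes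
    everywhere, hence is the zero polynomial. Cancelling the nonzero factors and evaluating at 0
    gives the claim. *)
Lemma rat_at0_eq (F : numFieldType) (f g : F -> F) :
  rat_at0 f -> rat_at0 g -> cofin (fun t => f t = g t) -> f 0 = g 0.
Proof.
move=> [p [r [r0 fE]]] [p' [r' [r0' gE]]] [b b0 hb].
have nz (s : {poly F}) : s.[0] != 0 -> s != 0.
  by apply: contra_neq => ->; rewrite horner0.
have : (p * r' - p' * r) * (r * r' * b) = 0.
  apply: poly_fun0 => t; rewrite !(hornerM, hornerD, hornerN).
  have [->|rt] := eqVneq r.[t] 0; first by rewrite !(mul0r, mulr0).
  have [->|rt'] := eqVneq r'.[t] 0; first by rewrite !(mul0r, mulr0).
  have [->|bt] := eqVneq b.[t] 0; first by rewrite !(mul0r, mulr0).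
  have := hb t bt; rewrite fE // gE // => /eqP; rewrite eqr_div // => /eqP ->.
  by rewrite subrr mul0r.
move/eqP; rewrite mulf_eq0 (negPf (mulf_neq0 (mulf_neq0 (nz _ r0) (nz _ r0')) b0)) orbF.
rewrite subr_eq0 => /eqP /(congr1 (horner^~ 0)); rewrite !hornerE => e.
by rewrite fE // gE //; apply/eqP; rewrite eqr_div //; apply/eqP.
Qed.

Ltac rat_at0_tac :=
  repeat first
  [ exact: rat_at0_cst | exact: rat_at0_id
  | apply: rat_at0_qpochs_nil | apply: rat_at0_qpochs_cons | apply: rat_at0_qpoch
  | apply: rat_at0_exp | apply: rat_at0_opp | apply: rat_at0_inv
  | apply: rat_at0_mul | apply: rat_at0_add ].

Theorem mainTheorem6 (R : realType) (q a c : R[i]) (l m n : nat)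
  (q_neq0 : q != 0) (a_neq0 : a != 0) (c_neq0 : c != 0)
  (* no zero factor in a denominator of the 4phi3 series *)
  (phi_den : forall k : nat, (k <= n)%N ->
    qpochs [:: q; q ^ (1 - l%:Z - n%:Z) / a; q ^ (1 - m%:Z - n%:Z) / c;
               - (a * c)] q k != 0)
  (* nor in the denominators of the prefactor *)
  (pre_den_l : qpochs [:: a ^+ 2; q ^+ n * a] q l != 0)
  (pre_den_n : qpochs [:: - (a * c); q ^+ m * c] q n != 0)
  (* nor in those of the terms of the double sum that are not read as 0 *)
  (T_den : forall i j : nat,
    (i <= l)%N -> (j <= m)%N -> (i + j <= n)%N -> ~~ odd (n - i - j) ->
    [/\ 1 - q^-1 * a ^+ 2 != 0,
        qpochs [:: q; q ^+ n * a ^+ 2; q ^+ l * a ^+ 2] q i != 0,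
        qpochs [:: q; q ^ (1 - n%:Z) / a; - q ^ (1 - n%:Z) / a;
                   q ^+ m * c ^+ 2; q ^ (j%:Z - 1) * c ^+ 2] q j != 0
      & qpochs [:: q ^ (2 - 2 * n%:Z + 2 * j%:Z) / a ^+ 2;
                   q ^+ (1 + 2 * j) * c ^+ 2]
               (q ^+ 2) (n - i - j)./2 != 0]) :
  phi43 n a c (- q ^ (1 - l%:Z - m%:Z - n%:Z) / (a * c))
    (q ^ (1 - l%:Z - n%:Z) / a) (q ^ (1 - m%:Z - n%:Z) / c) (- (a * c)) q q
  = qpochs [:: a; q ^+ n * a ^+ 2] q l / qpochs [:: a ^+ 2; q ^+ n * a] q l
    * (qpochs [:: - a; q ^+ m * c ^+ 2] q n
       / qpochs [:: - (a * c); q ^+ m * c] q n)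
    * \sum_(i < l.+1) \sum_(j < m.+1) T q a c l m n i j.

Proof.
pose lhs a c := phi43 n a c (- q ^ (1 - l%:Z - m%:Z - n%:Z) / (a * c))
    (q ^ (1 - l%:Z - n%:Z) / a) (q ^ (1 - m%:Z - n%:Z) / c) (- (a * c)) q q.
pose rhs a c := dixon_pref q a c l m n * \sum_(i < l.+1) \sum_(j < m.+1) T q a c l m n i j.
suff : lhs (a + 0) (c + 0) = rhs (a + 0) (c + 0) by rewrite !addr0.
apply: (@rat_at0_eq _ (fun t => lhs (a + t) (c + t)) (fun t => rhs (a + t) (c + t))).
- apply: rat_at0_sum => k; have := phi_den k (ltn_ord k : k < n.+1)%N.
  by move=> hk; rat_at0_tac; rewrite /= ?addr0 // mulf_neq0.
- rewrite /rhs /dixon_pref; apply: rat_at0_mul.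
    by rat_at0_tac; rewrite /= !addr0.
  apply: rat_at0_sum => i; apply: rat_at0_sum => j.
  (* [T_den] says nothing about the odd terms, but these vanish for every t. *)
  have [o|e] := boolP (odd (n - i - j)).
    rewrite (_ : (fun t => _) = (fun=> 0)); first exact: rat_at0_cst.
    by apply: boolp.funext => t; rewrite T_odd.
  rewrite /T; case ijn: (i + j <= n)%N; last exact: rat_at0_cst.
  have [dD d1 d2 d3] := T_den i j (ltn_ord i : i < l.+1)%N (ltn_ord j : j < m.+1)%N ijn e.
  by rat_at0_tac; rewrite /= ?addr0 ?mulf_neq0 ?expf_neq0.
have hq : qpoch q q n != 0.
  by move: (phi_den n (leqnn n)); rewrite qpochs_cons mulf_eq0 => /norP[].
pose M := (l + m + n).+1.*2.
have hE := (@hornerM R[i], @hornerD R[i], @hornerN R[i], @hornerC R[i], @hornerX R[i],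
  @horner_exp R[i]).
have cof_add (x : R[i]) : cofin (fun t => x + t != 0).
  have px : (x%:P + 'X).[1 - x] != 0 by rewrite !hE addrC subrK oner_eq0.
  have [b b0 hb] := cofin_poly px.
  by exists b => // t /hb; rewrite !hE.
(* At a root of p the polynomial q^z p - q takes the value -q, so it is not zero. The roots used
   below are -a and -c. *)
have cof_nonres (p : {poly R[i]}) x : p.[x] = 0 -> cofin (fun t => nonres q M p.[t]).
  move=> px; apply: cofin_forall => z.
  have pz : (p * (q ^+ z)%:P - q%:P).[x] != 0.
    by rewrite !hE px mul0r sub0r oppr_eq0.
  have [b b0 hb] := cofin_poly pz.
  by exists b => // t /hb; rewrite !hE subr_eq0.
have cofa : cofin (fun t => nonres q M ((a + t) ^+ 2)).
  have px : ((a%:P + 'X) ^+ 2).[- a] = 0 by rewrite !hE subrr ?expr0n ?mul0r.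
  have [b b0 hb] := cof_nonres _ _ px.
  by exists b => // t /hb; rewrite !hE.
have cofc : cofin (fun t => nonres q M ((c + t) ^+ 2)).
  have px : ((c%:P + 'X) ^+ 2).[- c] = 0 by rewrite !hE subrr ?expr0n ?mul0r.
  have [b b0 hb] := cof_nonres _ _ px.
  by exists b => // t /hb; rewrite !hE.
have cofac : cofin (fun t => nonres q M (((a + t) * (c + t)) ^+ 2)).
  have px : (((a%:P + 'X) * (c%:P + 'X)) ^+ 2).[- a] = 0.
    by rewrite !hE subrr ?mul0r ?expr0n ?mul0r.
  have [b b0 hb] := cof_nonres _ _ px.
  by exists b => // t /hb; rewrite !hE.
have [b b0 hb] := cofinI (cof_add a) (cofinI (cof_add c) (cofinI cofa (cofinI cofc cofac))).
exists b => // t /hb[a0 [c0 [na [nc nac]]]].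
rewrite /rhs -dixon_double_sum ?pnatr_eq0 // /lhs /phi_dixon.
have q1z k : q ^ (1 - k%:Z) = q / q ^+ k by rewrite expfzDr // expr1z -exprnN.
have qn0 k : q ^+ k != 0 by rewrite expf_neq0.
have -> : 1 - l%:Z - n%:Z = 1 - (l + n)%:Z by rewrite PoszD; ring.
have -> : 1 - m%:Z - n%:Z = 1 - (m + n)%:Z by rewrite PoszD; ring.
have -> : 1 - l%:Z - m%:Z - n%:Z = 1 - (l + m + n)%:Z by rewrite !PoszD; ring.
rewrite !q1z !exprD; congr phi43; field; nz.
Qed.
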